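(* Let $\phi:(M,g,J)\to(N,h,J^N)$ be a horizontally conformal holomorphic map from an almost Hermitian manifold to a Hermitian manifold, with fibres of complex dimension $1$. Let $\mathcal V=\ker d\phi$ and $\mathcal H=\mathcal V^\perp$. If (i) the fibres of $\phi$ are superminimal with respect to $J$, and (ii) the horizontal distribution $\mathcal H$ satisfies $[\mathcal H^{1,0},\mathcal H^{1,0}]^{\mathcal V}\subset\mathcal V^{1,0}$, then $J$ is integrable.
   Context: An almost Hermitian manifold $(M,g,J)$ is a Riemannian manifold $(M,g)$ of even real dimension with an almost complex structure $J:TM\to TM$, $J^2=-I$, which is isometric on each tangent space. It is Hermitian if $J$ is integrable, equivalently (Newlander–Nirenberg) if $T^{1,0}M$ is closed under the Lie bracket, where $T^{\mathbb C}M=T^{1,0}M\oplus T^{0,1}M$ is the decomposition into the $\pm i$-eigenspaces of $J$. A smooth map $\phi:M\to N$ between almost Hermitian manifolds is holomorphic if $d\phi\circ J=J^N\circ d\phi$. The map $\phi$ is horizontally conformal if at every $x\in M$, with $\mathcal V_x=\ker d\phi_x$ and $\mathcal H_x=\mathcal V_x^\perp$, the restriction $d\phi_x|_{\mathcal H_x}$ is a conformal linear map onto $T_{\phi(x)}N$ (so $\phi$ is a submersion). Since $\phi$ is holomorphic, $\mathcal V$ and $\mathcal H$ are $J$-invariant; $\mathcal V^{1,0}$ and $\mathcal H^{1,0}$ denote the intersections of $T^{1,0}M$ with the complexifications of $\mathcal V$ and $\mathcal H$. The superscript $\mathcal V$ on a vector field denotes its orthogonal projection to (the complexification of) $\mathcal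 V$; condition (ii) means that for all sections $Z,W$ of $\mathcal H^{1,0}$ the vertical part of $[Z,W]$ is a section of $\mathcal V^{1,0}$. An almost complex submanifold $F$ of $(M,g,J)$ is superminimal if $\nabla_VJ=0$ for all vectors $V$ tangent to $F$, where $\nabla$ is the Levi-Civita connection of $(M,g)$. *)

(* Defs.v *)
(* Real m-dimensional smooth manifolds are given by atlases with charts in
   'rV[R]_m, for R : realType.  A preferred chart is fixed at each point x, and
   the tangent space T_x M is 'rV[R]_m, a row listing the components of a tangent
   vector in the preferred chart at x.  Linear maps between tangent spaces act on
   rows on the right: v *m A is A(v), and A *m B is "A, then B". *)
From HB Require Import structures.
From mathcomp Require Import all_boot all_order all_algebra.
From mathcomp Require Import all_classical all_reals all_analysis.
From mathcomp Require Import complex ring.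

Set Implicit Arguments.
Unset Strict Implicit.
Unset Printing Implicit Defensive.

Import Order.TTheory GRing.Theory Num.Theory.
Import numFieldNormedType.Exports.

Local Open Scope classical_set_scope.
Local Open Scope ring_scope.

Section Smoothness.
Context {R : realType} {V W : normedModType R}.

Fixpoint Ck_on (k : nat) (U : set V) (f : V -> W) : Prop :=
  match k with
  | 0 => forall p, U p -> {for p, continuous f}
  | k'.+1 => (forall p, U p -> differentiable f p) /\
             (forall v, Ck_on k' U ('D_v f))
  end.

(* Meant for open U. *)
Definition smooth_on (U : set V) (f : V -> W) : Prop := forall k, Ck_on k U f.

End Smoothness.

Record chart (R : realType) (m : nat) (T : topologicalType) := Chart {
  cdom : set T;
  cmap : T -> 'rV[R]_m;
  cinv : 'rV[R]_m -> T;
  _ : open cdom;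
  _ : open (cmap @` cdom);
  _ : forall x, cdom x -> cinv (cmap x) = x;
  _ : forall x, cdom x -> {for x, continuous cmap};
  _ : forall p, (cmap @` cdom) p -> {for p, continuous cinv}
}.

Definition cimg (R : realType) (m : nat) (T : topologicalType)
    (c : chart R m T) (A : set T) : set 'rV[R]_m :=
  cmap c @` (A `&` cdom c).

Record smoothManifold (R : realType) (m : nat) := SmoothManifold {
  carrier :> topologicalType;
  atlas : set (chart R m carrier);
  chart_at : carrier -> chart R m carrier;
  _ : hausdorff_space carrier;
  _ : @second_countable carrier;
  _ : forall x, atlas (chart_at x) /\ cdom (chart_at x) x;
  _ : forall c c', atlas c -> atlas c' ->
        smooth_on (cimg c (cdom c')) (cmap c' \o cinv c)
}.

Lemma chart_atP (R : realType) (m : nat) (M : smoothManifold R m) (x : M) :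
  atlas (chart_at x) /\ cdom (chart_at x) x.
Proof. by move: x; case: M. Qed.

Section Readings.
Context {R : realType} {m : nat} {M : smoothManifold R m}.
Implicit Types (c : chart R m M) (x : M).

Definition pt x : 'rV[R]_m := cmap (chart_at x) x.

(* Change of components at x, from the chart c to the chart c'. *)
Definition dtrans c c' x : 'M[R]_m := jacobian (cmap c' \o cinv c) (cmap c x).

(* Components, in the chart c, of a vector field, a field of endomorphisms and a
   field of bilinear forms u, v |-> u *m g x *m v^T. *)
Definition field_in c (X : M -> 'rV[R]_m) (p : 'rV[R]_m) : 'rV[R]_m :=
  let x := cinv c p in X x *m dtrans (chart_at x) c x.

Definition endo_in c (A : M -> 'M[R]_m) (p : 'rV[R]_m) : 'M[R]_m :=
  let x := cinv c p in
  dtrans c (chart_at x) x *m A x *m dtrans (chart_at x) c x.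

Definition form_in c (g : M -> 'M[R]_m) (p : 'rV[R]_m) : 'M[R]_m :=
  let x := cinv c p in
  dtrans c (chart_at x) x *m g x *m (dtrans c (chart_at x) x)^T.

Definition smooth_endo (A : M -> 'M[R]_m) : Prop :=
  forall c, atlas c -> smooth_on (cimg c setT) (endo_in c A).

Definition smooth_form (g : M -> 'M[R]_m) : Prop :=
  forall c, atlas c -> smooth_on (cimg c setT) (form_in c g).

Definition smooth_field (U : set M) (X : M -> 'rV[R]_m) : Prop :=
  forall c, atlas c -> smooth_on (cimg c U) (field_in c X).

Definition bracket (X Y : M -> 'rV[R]_m) x : 'rV[R]_m :=
  'D_(X x) (field_in (chart_at x) Y) (pt x)
  - 'D_(Y x) (field_in (chart_at x) X) (pt x).

End Readings.

Section Maps.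
Context {R : realType} {m n : nat}.
Context {M : smoothManifold R m} {N : smoothManifold R n}.

Definition smooth_map (phi : M -> N) : Prop :=
  continuous phi /\
  forall c c', atlas c -> atlas c' ->
    smooth_on (cimg c (phi @^-1` cdom c')) (cmap c' \o phi \o cinv c).

Definition mdiff (phi : M -> N) (x : M) : 'M[R]_(m, n) :=
  jacobian (cmap (chart_at (phi x)) \o phi \o cinv (chart_at x)) (pt x).

End Maps.

Record almostHermitian (R : realType) (m : nat) := AlmostHermitian {
  manifold :> smoothManifold R m;
  metric : manifold -> 'M[R]_m;
  acs : manifold -> 'M[R]_m;
  _ : smooth_form metric;
  _ : forall x, (metric x)^T = metric x;
  _ : forall x (v : 'rV[R]_m), v != 0 -> 0 < (v *m metric x *m v^T) 0 0;
  _ : smooth_endo acs;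
  _ : forall x, acs x *m acs x = - 1%:M;
  _ : forall x, acs x *m metric x *m (acs x)^T = metric x
}.

Section MetricAccessors.
Context {R : realType} {m : nat} (M : almostHermitian R m).

Lemma metric_smooth : smooth_form (@metric R m M).
Proof. by case: M. Qed.

Lemma metric_sym (x : M) : (metric x)^T = metric x.
Proof. by move: x; case: M. Qed.

Lemma metric_gt0 (x : M) (v : 'rV[R]_m) :
  v != 0 -> 0 < (v *m metric x *m v^T) 0 0.
Proof. by move: x v; case: M. Qed.

Lemma metric_unit (x : M) : metric x \in unitmx.
Proof.
rewrite -row_free_unit -kermx_eq0; apply/rowV0P => v /sub_kermxP vg0.
apply/eqP; apply: contraT => /(metric_gt0 x).
by rewrite vg0 mul0mx mxE ltxx.
Qed.

End MetricAccessors.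

Section LeviCivita.
Context {R : realType} {m : nat} {M : almostHermitian R m}.
Implicit Types (x : M) (u v w : 'rV[R]_m).

Definition ip x u v : R := (u *m metric x *m v^T) 0 0.

(* u^k v^i w^j d_k g_ij at x, in the preferred chart at x. *)
Definition dmetric x u v w : R :=
  (v *m 'D_u (form_in (chart_at x) (@metric R m M)) (pt x) *m w^T) 0 0.

(* v^i w^j Gamma_ij^k, with
   Gamma_ij^k = g^kl (d_i g_jl + d_j g_il - d_l g_ij) / 2. *)
Definition christoffel x v w : 'rV[R]_m :=
  (\row_l (2^-1 * (dmetric x v w 'e_l + dmetric x w v 'e_l
                   - dmetric x 'e_l v w))) *m invmx (metric x).

Lemma form_in_differentiable x :
  differentiable (form_in (chart_at x) (@metric R m M)) (pt x).
Proof.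
have [Ax dx] := chart_atP x.
by have [+ _] := metric_smooth Ax 1; apply; exists x.
Qed.

Lemma dmetricC x u v w : dmetric x u v w = dmetric x u w v.
Proof.
rewrite /dmetric; set F := form_in _ _.
have FT p : (F p)^T = F p.
  by rewrite /F /form_in !trmx_mul trmxK metric_sym mulmxA.
have dF : differentiable F (pt x) by exact: form_in_differentiable.
have DT : ('D_u F (pt x))^T = 'D_u F (pt x).
  clearbody F; rewrite derive_mx; last exact: diff_derivable.
  apply/matrixP => i j; rewrite mxE [LHS]mxE [RHS]mxE.
  have -> : (fun p => F p j i) = (fun p => F p i j); last by [].
  by apply/funext => p; rewrite -[in RHS]FT mxE.
clearbody F; move: ('D_u F (pt x)) DT => D DT.
have -> : v *m D *m w^T = (w *m D *m v^T)^T.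
  by rewrite !trmx_mul trmxK DT mulmxA.
by rewrite mxE.
Qed.

Lemma dmetric_sum x u v w :
  dmetric x u v w = \sum_l u 0 l * dmetric x 'e_l v w.
Proof.
have dF := form_in_differentiable x.
rewrite /dmetric deriveE // [in LHS](row_sum_delta u) linear_sum /=.
rewrite mulmx_sumr mulmx_suml summxE; apply: eq_bigr => l _.
by rewrite linearZ /= -scalemxAr -scalemxAl mxE -deriveE.
Qed.

Lemma christoffelC x v w : christoffel x v w = christoffel x w v.
Proof.
congr (_ *m _); apply/rowP => l; rewrite mxE [RHS]mxE.
by rewrite (dmetricC x 'e_l w v) [in RHS](addrC (dmetric x w v 'e_l)).
Qed.

Lemma ip_christoffel x v w u :
  ip x (christoffel x v w) u =
  2^-1 * (dmetric x v w u + dmetric x w v u - dmetric x u v w).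
Proof.
rewrite /ip /christoffel mulmxKV ?metric_unit // mxE.
have dmetricE a b : dmetric x a b u = \sum_l dmetric x a b 'e_l * u 0 l.
  rewrite {1}/dmetric [in LHS](row_sum_delta u) linear_sum /= mulmx_sumr summxE.
  by apply: eq_bigr => l _; rewrite linearZ /= -scalemxAr mxE mulrC.
rewrite !dmetricE (dmetric_sum x u) -sumrN -!big_split mulr_sumr /=.
apply: eq_bigr => l _; rewrite mxE [u^T l 0]mxE.
move: (dmetric _ _ _ _) (dmetric _ _ _ _) (dmetric _ _ _ _) (u 0 l) => a b c d.
by ring.
Qed.

(* The Levi-Civita connection is metric and torsion-free. *)
Lemma christoffel_metric x v w u :
  dmetric x v w u = ip x (christoffel x v w) u + ip x w (christoffel x v u).
Proof.
have ipC a b : ip x a b = ip x b a.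
  rewrite /ip.
  have -> : a *m metric x *m b^T = (b *m metric x *m a^T)^T.
    by rewrite !trmx_mul trmxK metric_sym mulmxA.
  by rewrite mxE.
rewrite (ipC w) !ip_christoffel (dmetricC x v u w).
move: (dmetric _ _ _ _) (dmetric _ _ _ _) (dmetric _ _ _ _) => a b c.
by field.
Qed.

(* The Levi-Civita covariant derivative of X at x in the direction v. *)
Definition nabla x v (X : M -> 'rV[R]_m) : 'rV[R]_m :=
  'D_v (field_in (chart_at x) X) (pt x) + christoffel x v (X x).

Lemma nabla_torsion_free (X Y : M -> 'rV[R]_m) x :
  nabla x (X x) Y - nabla x (Y x) X = bracket X Y x.
Proof. by rewrite /nabla /bracket christoffelC opprD addrACA subrr addr0. Qed.

(* nabla_v J = 0 for all x in F and v in T_x F, where T_x F is the row space of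
   TF x and (nabla_v J)(X) = nabla_v (J X) - J (nabla_v X). *)
Definition superminimal (F : set M) (TF : M -> 'M[R]_m) : Prop :=
  forall (U : set M) (X : M -> 'rV[R]_m) x v,
    open U -> smooth_field U X -> U x -> F x -> (v <= TF x)%MS ->
    nabla x v (fun y => X y *m acs y) = nabla x v X *m acs x.

End LeviCivita.

Section Complexified.
Context {R : realType} {m : nat} {M : almostHermitian R m}.
Implicit Types (x : M) (Z W : M -> 'rV[R[i]]_m).

Definition cplx (a b : nat) (A : 'M[R]_(a, b)) : 'M[R[i]]_(a, b) :=
  map_mx (real_complex R) A.

Definition re_field Z (x : M) : 'rV[R]_m := map_mx (@complex.Re R) (Z x).
Definition im_field Z (x : M) : 'rV[R]_m := map_mx (@complex.Im R) (Z x).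

Definition smooth_cfield (U : set M) Z : Prop :=
  smooth_field U (re_field Z) /\ smooth_field U (im_field Z).

(* The complex bilinear extension of the Lie bracket. *)
Definition cbracket Z W x : 'rV[R[i]]_m :=
  cplx (bracket (re_field Z) (re_field W) x
        - bracket (im_field Z) (im_field W) x)
  + 'i%C *: cplx (bracket (re_field Z) (im_field W) x
                  + bracket (im_field Z) (re_field W) x).

Definition T10 x (z : 'rV[R[i]]_m) : Prop := z *m cplx (acs x) = 'i%C *: z.

End Complexified.

(* T^{1,0} M is closed under the Lie bracket of local sections. *)
Definition integrable_acs (R : realType) (m : nat) (M : almostHermitian R m) :
    Prop :=
  forall (U : set M) (Z W : M -> 'rV[R[i]]_m),
    open U -> smooth_cfield U Z -> smooth_cfield U W ->
    (forall x, U x -> T10 x (Z x)) -> (forall x, U x -> T10 x (W x)) ->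
    forall x, U x -> T10 x (cbracket Z W x).

Section Submersions.
Context {R : realType} {m n : nat}.
Context {M : almostHermitian R m} {N : almostHermitian R n}.
Implicit Types (phi : M -> N) (x : M).

Definition holomorphic_map phi : Prop :=
  smooth_map phi /\
  forall x, acs x *m mdiff phi x = mdiff phi x *m acs (phi x).

(* Square matrices whose row spaces are V_x = ker d(phi)_x and its
   metric-orthogonal complement H_x. *)
Definition vert phi x : 'M[R]_m := kermx (mdiff phi x).
Definition hor phi x : 'M[R]_m := kermx (metric x *m (vert phi x)^T).

Definition horizontally_conformal phi : Prop :=
  forall x,
    row_full (hor phi x *m mdiff phi x) /\
    exists2 lambda : R, 0 < lambda &
      forall u v : 'rV[R]_m, (u <= hor phi x)%MS -> (v <= hor phi x)%MS ->
        ip (phi x) (u *m mdiff phi x) (v *m mdiff phi x)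
          = lambda ^+ 2 * ip x u v.

(* Orthogonal projection onto V_x. *)
Definition vproj phi x : 'M[R]_m := proj_mx (vert phi x) (hor phi x).

Definition V10 phi x (z : 'rV[R[i]]_m) : Prop :=
  T10 x z /\ (z <= cplx (vert phi x))%MS.
Definition H10 phi x (z : 'rV[R[i]]_m) : Prop :=
  T10 x z /\ (z <= cplx (hor phi x))%MS.

Definition H10_bracket_in_V10 phi : Prop :=
  forall (U : set M) (Z W : M -> 'rV[R[i]]_m),
    open U -> smooth_cfield U Z -> smooth_cfield U W ->
    (forall x, U x -> H10 phi x (Z x)) -> (forall x, U x -> H10 phi x (W x)) ->
    forall x, U x -> V10 phi x (cbracket Z W x *m cplx (vproj phi x)).

(* The fibre phi^{-1}(y) has tangent space V_x at x. *)
Definition superminimal_fibres phi : Prop :=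
  forall y : N, superminimal (phi @^-1` [set y]) (vert phi).

End Submersions.

(* Main.v *)
(* Integrability of J is the vanishing of its Nijenhuis tensor
     N(X,Y) = [JX,JY] - J[JX,Y] - J[X,JY] - [X,Y],
   which is tensorial, and natural under holomorphic maps:
   d(phi) N(X,Y) = N'(d(phi) X, d(phi) Y), where N' = 0 is the Nijenhuis tensor of
   the target.  So N takes vertical values.  It vanishes on two horizontal
   vectors by (ii), applied to horizontal (1,0)-sections through them.  If V is
   vertical, superminimality gives
   N(X,V) = (nabla_JX J)V - J (nabla_X J)V; since nabla_X J is skew and
   anticommutes with J, (nabla_X J)V is orthogonal to V and JV, which span the
   fibre direction.  Hence N(X,V) is both vertical and horizontal, that is, 0. *)
Require Import Defs.
From mathcomp Require Import all_boot all_order all_algebra.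
From mathcomp Require Import all_classical all_reals all_analysis.
From mathcomp Require Import complex ring lra.

Section SubmersionsWithSuperminimalFibres.
Set Implicit Arguments.
Unset Strict Implicit.
Unset Printing Implicit Defensive.
Import Order.TTheory GRing.Theory Num.Theory.
Import numFieldNormedType.Exports.
Local Open Scope classical_set_scope.
Local Open Scope ring_scope.

(** * The algebra of smooth functions *)

Section Calculus.
Context {R : realType}.

(** Integrability and condition (ii) speak of complex sections, the tensor N of real vectors. One
    identity links them: if (1,0)-sections with real parts X and Y have bracket P + iQ, then JP + Q
    = -J N(X,Y), and JP + Q = 0 says exactly that the bracket is of type (1,0). Condition (ii) only
    kills the vertical projection of JP + Q; integrability of the target makes N vertical, so the
    projection loses nothing. N is defined in a chart from the value and the first derivatives of J,
    which turns tensoriality into an algebraic identity. Naturality brings in the second derivatives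
    of the map, hence the need for their symmetry, obtained here from the mean value theorem.
    Condition (ii) says something only about sections that are horizontal on a whole open set;
    extending a single horizontal vector to such a smooth section is the one geometric
    construction. *)

Lemma near_eq_differentiable (V W : normedModType R) (f g : V -> W) (x : V) :
  {near x, f =1 g} -> differentiable f x -> differentiable g x.
Proof.
move=> fg df; have fgx := fg; have [dfc /eqaddoP dfo] := (diff_locallyP _ _).1 df.
have dgo : g \o shift x = cst (g x) + 'd f x +o_ 0 id.
  apply/eqaddoP => e e0; move: (dfo e e0).
  apply: filter_app; rewrite (near_shift 0) /= in fg.
  apply: filterS fg => y; rewrite subr0 /= => fg.
  rewrite /cst /GRing.add /GRing.opp /= /shift /= -fg -(nbhs_singleton fgx).
  by [].
by apply/(diff_locallyP x g); rewrite (diff_unique dfc dgo); split.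
Qed.

Lemma open_near_eq (V W : normedModType R) (U : set V) (f g : V -> W) p :
  open U -> U p -> (forall q, U q -> f q = g q) -> {near p, f =1 g}.
Proof. by move=> oU Up fg; apply: filterS (open_nbhs_nbhs (conj oU Up)). Qed.

Section Ck.
Context {V W : normedModType R}.
Implicit Types (U : set V) (f g : V -> W).

Lemma open_eq_derive U f g v p :
  open U -> U p -> (forall q, U q -> f q = g q) -> 'D_v f p = 'D_v g p.
Proof. by move=> oU Up fg; apply: near_eq_derive; apply: open_near_eq Up fg. Qed.

(** Functions are total, while chart expressions agree only on the image of a chart domain; on an
    open set such an agreement passes to every iterated derivative. *)
Lemma Ck_on_eq k U f g :
  open U -> (forall q, U q -> f q = g q) -> Ck_on k U f -> Ck_on k U g.
Proof.
move=> oU; elim: k f g => [|k IH] f g fg /=.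
  move=> cf p Up; have cfp : f @ p --> f p := cf p Up.
  suff: g @ p --> g p by []; rewrite -(fg p Up); apply: cvg_trans cfp.
  by apply: near_eq_cvg; apply: open_near_eq Up fg.
move=> [df Df]; split=> [p Up|v].
  by apply: near_eq_differentiable (df p Up); apply: open_near_eq Up fg.
apply: IH (Df v) => q Uq; exact: open_eq_derive Uq fg.
Qed.

Lemma Ck_onS k U f : Ck_on k.+1 U f -> Ck_on k U f.
Proof.
elim: k f => [|k IH] f.
  by move=> [df _] p Up; apply: differentiable_continuous; exact: df.
by case=> df Df; split=> // v; apply: IH.
Qed.

Lemma Ck_on_subset k U U' f : U' `<=` U -> Ck_on k U f -> Ck_on k U' f.
Proof.
move=> sU; elim: k f => [|k IH] f /=; first by move=> + p /sU; apply.
by case=> df Df; split=> [p /sU|v]; [exact: df|apply: IH].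
Qed.

Lemma Ck_on_diff k U f p : Ck_on k.+1 U f -> U p -> differentiable f p.
Proof. by case=> + _; apply. Qed.

Lemma Ck_on_cst k U (w : W) : Ck_on k U (fun=> w).
Proof.
elim: k w => [|k IH] w /=; first by move=> p _; exact: cst_continuous.
split=> [p _|v]; first exact: differentiable_cst.
rewrite (_ : 'D_v _ = fun=> 0); first exact: IH.
by apply/funext => p; exact: derive_cst.
Qed.

Lemma Ck_onD k U f g : open U -> Ck_on k U f -> Ck_on k U g ->
  Ck_on k U (fun p => f p + g p).
Proof.
move=> oU; elim: k f g => [|k IH] f g /=.
  by move=> cf cg p Up; apply: cvgD; [exact: cf|exact: cg].
move=> [df Df] [dg Dg]; split=> [p Up|v].
  by apply: differentiableD; [exact: df|exact: dg].
apply: (@Ck_on_eq _ _ (fun p => 'D_v f p + 'D_v g p)) => //; last exact: IH.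
by move=> q Uq; rewrite -deriveD //; apply: diff_derivable; auto.
Qed.

Lemma Ck_on_sum k U (I : Type) (r : seq I) (P : pred I) (f : I -> V -> W) :
  open U -> (forall i, P i -> Ck_on k U (f i)) ->
  Ck_on k U (fun p => \sum_(i <- r | P i) f i p).
Proof.
move=> oU Cf; elim: r => [|i r IH].
  by under eq_fun do rewrite big_nil; exact: Ck_on_cst.
under eq_fun do rewrite big_cons.
by case Pi: (P i) => //; apply: Ck_onD => //; apply: Cf.
Qed.

Lemma Ck_onZl k U (f : V -> R) (w : W) :
  open U -> Ck_on k U f -> Ck_on k U (fun p => f p *: w).
Proof.
move=> oU; elim: k f => [|k IH] f /=.
  by move=> cf p Up; apply: cvgZr_tmp; exact: cf.
move=> [df Df]; split=> [p Up|v]; first by apply: differentiableZl; exact: df.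
apply: (@Ck_on_eq _ _ (fun p => 'D_v f p *: w)) => //; last exact: IH.
move=> q Uq; have dfq := df q Uq.
by rewrite [RHS]deriveE ?diffZl ?deriveE //; exact: differentiableZl.
Qed.

End Ck.

(** The product rule brings back [f] and [g] themselves next to their derivatives, so the induction
    also uses them one order lower, through [Ck_onS]. *)
Lemma Ck_onM (V : normedModType R) k (U : set V) (f g : V -> R) :
  open U -> Ck_on k U f -> Ck_on k U g -> Ck_on k U (fun p => f p * g p).
Proof.
move=> oU; elim: k f g => [|k IH] f g.
  by move=> cf cg p Up; apply: cvgM; [exact: cf|exact: cg].
move=> Cf Cg; have [df Df] := Cf; have [dg Dg] := Cg.
split=> [p Up|v].
  by apply: differentiableM; [exact: df|exact: dg].
apply: (@Ck_on_eq _ _ _ _ (fun p => f p * 'D_v g p + g p * 'D_v f p)) => //.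
  move=> q Uq; rewrite -[RHS]/('D_v (f * g) q) deriveM //.
    exact/diff_derivable/df.
  exact/diff_derivable/dg.
apply: Ck_onD => //; apply: IH.
- exact: Ck_onS Cf.
- exact: Dg.
- exact: Ck_onS Cg.
- exact: Df.
Qed.

Lemma Ck_on_prod (V : normedModType R) k (U : set V) (I : Type) (r : seq I)
    (P : pred I) (f : I -> V -> R) :
  open U -> (forall i, P i -> Ck_on k U (f i)) ->
  Ck_on k U (fun p => \prod_(i <- r | P i) f i p).
Proof.
move=> oU Cf; elim: r => [|i r IH].
  by under eq_fun do rewrite big_nil; exact: Ck_on_cst.
under eq_fun do rewrite big_cons.
by case Pi: (P i) => //; apply: Ck_onM => //; apply: Cf.
Qed.

Lemma differentiable_entry (V : normedModType R) a b (F : V -> 'M[R]_(a, b)) p i j :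
  differentiable F p -> differentiable (fun q => F q i j) p.
Proof.
move=> dF; apply: (@differentiable_comp _ _ _ _ F (fun N : 'M[R]_(a, b) => N i j)) => //.
exact: differentiable_coord.
Qed.

Lemma derive_entry (V : normedModType R) a b (F : V -> 'M[R]_(a, b)) p v i j :
  differentiable F p -> 'D_v (fun q => F q i j) p = 'D_v F p i j.
Proof.
by move=> dF; rewrite (derive_mx (diff_derivable dF)) mxE.
Qed.

Lemma mx_sum_delta_fun (V : Type) a b (F : V -> 'M[R]_(a, b)) :
  F = fun q => \sum_i \sum_j F q i j *: delta_mx i j.
Proof. by apply/funext => q; exact: matrix_sum_delta. Qed.

Lemma differentiable_mx (V : normedModType R) a b (F : V -> 'M[R]_(a, b)) p :
  (forall i j, differentiable (fun q => F q i j) p) -> differentiable F p.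
Proof.
move=> dF; rewrite (mx_sum_delta_fun F) -fct_sumE.
apply: differentiable_sum => i; rewrite -fct_sumE.
by apply: differentiable_sum => j; apply: differentiableZl.
Qed.

(** Reduces matrix-valued smoothness to scalar functions, where products, and with them matrix
    products and adjugates, are available. *)
Lemma Ck_on_mxP (V : normedModType R) k (U : set V) a b (F : V -> 'M[R]_(a, b)) :
  open U ->
  Ck_on k U F <-> (forall i j, Ck_on k U (fun q => F q i j)).
Proof.
move=> oU; split=> [CF i j|CF]; last first.
  rewrite (mx_sum_delta_fun F); apply: Ck_on_sum => // i _.
  by apply: Ck_on_sum => // j _; apply: Ck_onZl.
elim: k F CF => [|k IH] F.
  move=> cF p Up.
  apply: (@continuous_comp _ _ _ F (fun N : 'M[R]_(a, b) => N i j)); first exact: cF.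
  exact: coord_continuous.
move=> [dF DF]; split=> [p Up|v].
  by apply: differentiable_entry; exact: dF.
apply: Ck_on_eq (IH _ (DF v)) => // q Uq.
by rewrite derive_entry //; exact: dF.
Qed.

Lemma derive_comp_rV (W : normedModType R) m n (f : 'rV[R]_n -> W)
    (t : 'rV[R]_m -> 'rV[R]_n) p v :
  differentiable t p -> differentiable f (t p) ->
  'D_v (f \o t) p = 'D_('D_v t p) f (t p).
Proof.
move=> dt df; rewrite deriveE; last exact: differentiable_comp.
by rewrite diff_comp //= deriveE // deriveE.
Qed.

Lemma derive_dir_sum (W : normedModType R) n (f : 'rV[R]_n -> W) p v :
  differentiable f p -> 'D_v f p = \sum_i v 0 i *: 'D_('e_i) f p.
Proof.
move=> df; rewrite deriveE // [in LHS](row_sum_delta v) linear_sum /=.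
by apply: eq_bigr => i _; rewrite linearZ /= -deriveE.
Qed.

Lemma Ck_on_comp k m n (U : set 'rV[R]_m) (U' : set 'rV[R]_n)
    (f : 'rV[R]_n -> R) (t : 'rV[R]_m -> 'rV[R]_n) :
  open U -> (forall p, U p -> U' (t p)) ->
  Ck_on k U' f -> Ck_on k U t -> Ck_on k U (f \o t).
Proof.
move=> oU tU; elim: k f => [|k IH] f.
  move=> cf ct p Up; apply: continuous_comp; first exact: ct.
  exact/cf/tU.
move=> Cf Ct; have [df Df] := Cf; have [dt Dt] := Ct.
split=> [p Up|v].
  by apply: differentiable_comp; [exact: dt|exact/df/tU].
(* The chain rule differentiates [f] in the direction ['D_v t p], which moves with [p], whereas
   [Ck_on] knows only fixed directions. Expanding it in the basis ['e_i] leaves fixed partial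
   derivatives of [f], to which the induction hypothesis applies. *)
apply: (@Ck_on_eq _ _ _ _
  (fun p => \sum_i 'D_v t p 0 i * ('D_('e_i) f \o t) p)) => //.
  move=> p Up; have dtp := dt p Up; have dfp := df _ (tU _ Up).
  by rewrite [RHS]derive_comp_rV // (derive_dir_sum _ dfp).
apply: Ck_on_sum => // i _; apply: Ck_onM => //.
  exact: (Ck_on_mxP k ('D_v t) oU).1 (Dt v) 0 i.
by apply: IH; [exact: Df|exact: Ck_onS Ct].
Qed.

Lemma smooth_on_mxP (V : normedModType R) (U : set V) a b (F : V -> 'M[R]_(a, b)) :
  open U ->
  smooth_on U F <-> (forall i j, smooth_on U (fun q => F q i j)).
Proof.
move=> oU; split=> [CF i j k|CF k]; first exact: (Ck_on_mxP k F oU).1.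
by apply/Ck_on_mxP => // i j; exact: CF.
Qed.

(** * Smooth matrix-valued functions on an open set of coordinates *)

Section SmoothMx.
Context {m : nat} {U : set 'rV[R]_m} (oU : open U).

Lemma smooth_diff (W : normedModType R) (f : 'rV[R]_m -> W) p :
  smooth_on U f -> U p -> differentiable f p.
Proof. by move=> /(_ 1%N); exact: Ck_on_diff. Qed.

Lemma smooth_on_derive (W : normedModType R) (f : 'rV[R]_m -> W) v :
  smooth_on U f -> smooth_on U ('D_v f).
Proof. by move=> Cf k; have [_ Df] := Cf k.+1; exact: Df. Qed.

Lemma smooth_on_eq (W : normedModType R) (f g : 'rV[R]_m -> W) :
  (forall q, U q -> f q = g q) -> smooth_on U f -> smooth_on U g.
Proof. by move=> fg Cf k; apply: Ck_on_eq (Cf k). Qed.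

Lemma smooth_on_cst (W : normedModType R) (w : W) : smooth_on U (fun=> w).
Proof. by move=> k; exact: Ck_on_cst. Qed.

Lemma smooth_onN (W : normedModType R) (f : 'rV[R]_m -> W) :
  smooth_on U f -> smooth_on U (fun p => - f p).
Proof.
move=> Cf k; elim: k f Cf => [|k IH] f Cf.
  by move=> p Up; apply: continuousN; exact: (Cf 0%N p Up).
split=> [p Up|v]; first by apply: differentiableN; exact: smooth_diff Up.
apply: Ck_on_eq (IH _ (smooth_on_derive v Cf)) => // q Uq.
by rewrite -deriveN //; apply: diff_derivable; exact: smooth_diff Uq.
Qed.

Lemma smooth_on_mulmx a b c (F : 'rV[R]_m -> 'M[R]_(a, b))
    (G : 'rV[R]_m -> 'M[R]_(b, c)) :
  smooth_on U F -> smooth_on U G -> smooth_on U (fun p => F p *m G p).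
Proof.
move=> /smooth_on_mxP-/(_ oU) CF /smooth_on_mxP-/(_ oU) CG.
apply/smooth_on_mxP => // i j k; under eq_fun do rewrite mxE.
by apply: Ck_on_sum => // l _; apply: Ck_onM => //; [exact: CF|exact: CG].
Qed.

Lemma smooth_on_trmx a b (F : 'rV[R]_m -> 'M[R]_(a, b)) :
  smooth_on U F -> smooth_on U (fun p => (F p)^T).
Proof.
move=> /smooth_on_mxP-/(_ oU) CF.
by apply/smooth_on_mxP => // i j k; under eq_fun do rewrite mxE; exact: CF.
Qed.

Lemma smooth_on_adjugate n (F : 'rV[R]_m -> 'M[R]_n) :
  smooth_on U F -> smooth_on U (fun p => \adj (F p)).
Proof.
move=> /smooth_on_mxP-/(_ oU) CF.
apply/smooth_on_mxP => // i j k; under eq_fun do rewrite mxE /cofactor /determinant.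
apply: Ck_onM => //; first exact: Ck_on_cst.
apply: Ck_on_sum => // s _; apply: Ck_onM => //; first exact: Ck_on_cst.
by apply: Ck_on_prod => // l _; under eq_fun do rewrite !mxE; exact: CF.
Qed.

Lemma smooth_on_comp n (U' : set 'rV[R]_n) a b (F : 'rV[R]_n -> 'M[R]_(a, b))
    (t : 'rV[R]_m -> 'rV[R]_n) :
  open U' -> (forall p, U p -> U' (t p)) ->
  smooth_on U' F -> smooth_on U t -> smooth_on U (F \o t).
Proof.
move=> oU' tU /smooth_on_mxP-/(_ oU') CF Ct.
apply/smooth_on_mxP => // i j k.
exact: (Ck_on_comp oU tU (CF i j k) (Ct k)).
Qed.

Lemma smooth_on_jacobian n (f : 'rV[R]_m -> 'rV[R]_n) :
  smooth_on U f -> smooth_on U (jacobian f).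
Proof.
move=> Cf; apply/smooth_on_mxP => // i j.
have := (smooth_on_mxP _ oU).1 (smooth_on_derive 'e_i Cf) 0 j.
apply: smooth_on_eq => q Uq; rewrite deriveEjacobian; last exact: smooth_diff Uq.
by rewrite -rowE mxE.
Qed.

End SmoothMx.

Lemma derive_mulmx (V : normedModType R) a b c (F : V -> 'M[R]_(a, b))
    (G : V -> 'M[R]_(b, c)) p v :
  differentiable F p -> differentiable G p ->
  'D_v (fun q => F q *m G q) p = 'D_v F p *m G p + F p *m 'D_v G p.
Proof.
move=> dF dG.
have dFG i j : differentiable (fun q => (F q *m G q) i j) p.
  under eq_fun do rewrite mxE; rewrite -fct_sumE.
  by apply: differentiable_sum => l; apply: differentiableM; exact: differentiable_entry.
apply/matrixP => i j; rewrite -derive_entry; last exact: differentiable_mx.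
rewrite !mxE -big_split /=; under eq_fun do rewrite mxE; rewrite -fct_sumE.
rewrite derive_sum; last first.
  move=> l; apply: diff_derivable; apply: differentiableM; exact: differentiable_entry.
apply: eq_bigr => l _.
rewrite -[LHS]/('D_v ((fun q => F q i l) * (fun q => G q l j)) p) deriveM.
- by rewrite !derive_entry // addrC; congr (_ + _); exact: mulrC.
- exact/diff_derivable/differentiable_entry.
- exact/diff_derivable/differentiable_entry.
Qed.

Lemma differentiable_mulmx (V : normedModType R) a b c (F : V -> 'M[R]_(a, b))
    (G : V -> 'M[R]_(b, c)) p :
  differentiable F p -> differentiable G p ->
  differentiable (fun q => F q *m G q) p.
Proof.
move=> dF dG; apply: differentiable_mx => i j.
under eq_fun do rewrite mxE; rewrite -fct_sumE.
by apply: differentiable_sum => l; apply: differentiableM; exact: differentiable_entry.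
Qed.

End Calculus.

(** * Symmetry of second derivatives *)

Section Schwarz.
Context {R : realType}.

(** The one-variable mean value theorem for [f] restricted to the segment [s |-> q + s *: v]. *)
Lemma MVT_line (V : normedModType R) (f : V -> R) (q v : V) (t : R) :
  0 < t -> (forall s, 0 <= s <= t -> differentiable f (q + s *: v)) ->
  exists2 s, 0 < s < t & f (q + t *: v) - f q = t * 'D_v f (q + s *: v).
Proof.
move=> t0 df; pose l (s : R) : V := q + s *: v.
have dl s : differentiable l s.
  apply: differentiableD; first exact: differentiable_cst.
  exact: differentiableZl.
have Dl s : 'd l s 1 = v.
  rewrite -deriveE // deriveD //; last exact/diff_derivable/differentiableZl.
  rewrite derive_cst add0r deriveE; last exact: differentiableZl.
  by rewrite diffZl // diff_val scale1r.
have D s : 0 <= s <= t -> is_derive s 1 (f \o l) ('D_v f (l s)).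
  move=> /df dfs; apply: DeriveDef.
    by apply/diff_derivable/differentiable_comp.
  rewrite deriveE; last exact/differentiable_comp.
  by rewrite diff_comp //= Dl -deriveE.
have cf : {within `[0, t], continuous (f \o l)}.
  apply: derivable_within_continuous => s; rewrite in_itv /= => st.
  by have [] := D s st.
have D' s : s \in `]0, t[%R -> is_derive s 1 (f \o l) ('D_v f (l s)).
  by rewrite in_itv /= => /andP[s0 st]; apply: D; rewrite !ltW.
have [s] := MVT t0 D' cf; rewrite in_itv /= => s0 E; exists s => //.
by move: E; rewrite /l /= scale0r addr0 subr0 mulrC.
Qed.

(** Two mean value theorems: along [u] for the increment [g] of [f] in the direction [v], then along
    [v] for ['D_u f]. *)
Lemma second_difference (V : normedModType R) (U : set V) (f : V -> R)
    (p u v : V) (t : R) :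
  0 < t -> (forall r s, 0 <= r <= t -> 0 <= s <= t -> U (p + r *: u + s *: v)) ->
  (forall q, U q -> differentiable f q) ->
  (forall q, U q -> differentiable ('D_u f) q) ->
  exists r s, [/\ 0 < r < t, 0 < s < t &
    f (p + t *: u + t *: v) - f (p + t *: u) - (f (p + t *: v) - f p)
    = t * t * 'D_v ('D_u f) (p + r *: u + s *: v)].
Proof.
move=> t0 Up df dDf; have tt : 0 <= t <= t by rewrite lexx ltW.
have t00 : (0 : R) <= 0 <= t by rewrite lexx ltW.
pose g (x : V) := f (x + t *: v) - f x.
have dt (x : V) : is_diff x (fun x => x + t *: v) id.
  have -> : (fun x => x + t *: v) = id + cst (t *: v) by [].
  by apply: is_diff_eq; rewrite addr0.
have dfs r : 0 <= r <= t -> differentiable (fun x => f (x + t *: v)) (p + r *: u).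
  move=> rt; apply: (@differentiable_comp _ _ _ _ (fun x => x + t *: v) f) => //.
  exact/df/Up.
have dfr r : 0 <= r <= t -> differentiable f (p + r *: u).
  by move=> rt; have := df _ (Up r 0 rt t00); rewrite scale0r addr0.
have [r rt Er] : exists2 r, 0 < r < t & g (p + t *: u) - g p = t * 'D_u g (p + r *: u).
  apply: MVT_line => // r rt; apply: differentiableB; [exact: dfs|exact: dfr].
have rt' : 0 <= r <= t by case/andP: rt => *; rewrite !ltW.
have Dg : 'D_u g (p + r *: u) = 'D_u f (p + r *: u + t *: v) - 'D_u f (p + r *: u).
  rewrite deriveB; [|exact/diff_derivable/dfs|exact/diff_derivable/dfr].
  congr (_ - _); rewrite deriveE; last exact: dfs.
  rewrite (@diff_comp _ _ _ _ (fun x => x + t *: v) f) //=; last exact/df/Up.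
  by rewrite diff_val -deriveE //; exact/df/Up.
have [s st Es] := @MVT_line V ('D_u f) (p + r *: u) v t t0
  (fun s st => dDf _ (Up r s rt' st)).
exists r, s; split=> //.
rewrite [LHS](_ : _ = g (p + t *: u) - g p); first by rewrite Er Dg Es mulrA.
by rewrite /g.
Qed.

Lemma half_dist_le (a b c e : R) :
  `|a - c| < e / 2 -> `|b - c| < e / 2 -> `|a - b| <= e.
Proof.
move=> ac bc; have := ler_distD c a b; rewrite [`|c - b|]distrC; lra.
Qed.

(** The second difference is symmetric in [u] and [v]. Divided by [t * t], it is therefore a value
    of either mixed derivative, each at some point near [p], and continuity at [p] forces the two to
    agree there. *)
Lemma derive_comm_scalar (V : normedModType R) (U : set V) (f : V -> R) (p u v : V) :
  open U -> U p ->
  (forall q, U q -> differentiable f q) ->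
  (forall w q, U q -> differentiable ('D_w f) q) ->
  {for p, continuous ('D_v ('D_u f))} -> {for p, continuous ('D_u ('D_v f))} ->
  'D_v ('D_u f) p = 'D_u ('D_v f) p.
Proof.
move=> oU Up df dDf cvu cuv; apply/eqP; rewrite -subr_eq0 -normr_le0.
apply/ler_addgt0Pr => e e0; rewrite add0r.
have e2 : 0 < e / 2 by rewrite divr_gt0.
have : \forall q \near p, [/\ U q, `|'D_v ('D_u f) p - 'D_v ('D_u f) q| < e / 2
   & `|'D_u ('D_v f) p - 'D_u ('D_v f) q| < e / 2].
  have N1 : nbhs p U by exact: open_nbhs_nbhs.
  have N2 : \forall q \near p, `|'D_v ('D_u f) p - 'D_v ('D_u f) q| < e / 2.
    exact: (cvgrPdist_lt _ _).1 cvu _ e2.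
  have N3 : \forall q \near p, `|'D_u ('D_v f) p - 'D_u ('D_v f) q| < e / 2.
    exact: (cvgrPdist_lt _ _).1 cuv _ e2.
  by apply: filterS (filterI N1 (filterI N2 N3)) => q [? []].
move=> /nbhs_normP[d /= d0 B].
(* The parallelogram with sides [t *: u] and [t *: v] at [p] must lie in the ball of radius [d]: the
   summand 1 keeps the denominator positive when [u] and [v] vanish, and the factor 1/2 makes the
   bound strict. *)
pose t := d / (`|u| + `|v| + 1) / 2.
have K0 : 0 < `|u| + `|v| + 1 by rewrite ltr_wpDl // addr_ge0.
have t0 : 0 < t by rewrite !divr_gt0.
have inB r s : 0 <= r <= t -> 0 <= s <= t -> `|p - (p + r *: u + s *: v)| < d.
  move=> /andP[r0 rt] /andP[s0 st].
  rewrite -addrA opprD addrA subrr sub0r normrN.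
  apply: le_lt_trans (ler_normD _ _) _; rewrite !normrZ !ger0_norm //.
  apply: (@le_lt_trans _ _ (t * `|u| + t * `|v|)).
    by rewrite lerD // ler_wpM2r.
  apply: (@le_lt_trans _ _ (t * (`|u| + `|v| + 1))).
    by rewrite -mulrDr ler_wpM2l ?(ltW t0) // lerDl.
  rewrite /t mulrAC divfK ?gt_eqF // ltr_pdivrMr // mulr_natr mulr2n.
  by rewrite ltrDl.
have inU r s : 0 <= r <= t -> 0 <= s <= t -> U (p + r *: u + s *: v).
  by move=> rt st; have [] := B _ (inB r s rt st).
have inU' s r : 0 <= s <= t -> 0 <= r <= t -> U (p + s *: v + r *: u).
  by move=> st rt; rewrite addrAC; exact: inU.
have [r [s [rt st E]]] := second_difference t0 inU df (dDf u).
have [s' [r' [st' rt' E']]] := second_difference t0 inU' df (dDf v).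
have in2 x : 0 < x < t -> 0 <= x <= t by case/andP => *; rewrite !ltW.
have [_ b1 _] := B _ (inB r s (in2 _ rt) (in2 _ st)).
have inB' : `|p - (p + s' *: v + r' *: u)| < d.
  by rewrite addrAC; exact: inB (in2 _ rt') (in2 _ st').
have [_ _ b2] := B _ inB'.
have EE : 'D_v ('D_u f) (p + r *: u + s *: v) = 'D_u ('D_v f) (p + s' *: v + r' *: u).
  apply: (@mulfI _ (t * t)); first by rewrite mulf_neq0 // gt_eqF.
  apply: (etrans (esym E) (etrans _ E')); rewrite (addrAC p (t *: v)).
  set x1 := f _; set x2 := f _; set x3 := f _; set x4 := f _; ring.
by rewrite EE in b1; exact: half_dist_le b1 b2.
Qed.

Lemma derive_comm m n (U : set 'rV[R]_m) (f : 'rV[R]_m -> 'rV[R]_n) p u v :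
  open U -> U p -> smooth_on U f -> 'D_v ('D_u f) p = 'D_u ('D_v f) p.
Proof.
move=> oU Up Cf.
have Cf2 w : smooth_on U ('D_w f) by exact: smooth_on_derive.
have Cf3 w w' : smooth_on U ('D_w ('D_w' f)) by exact: smooth_on_derive.
have E w q j : U q -> 'D_w f q 0 j = 'D_w (fun x => f x 0 j) q.
  by move=> Uq; rewrite derive_entry //; exact: smooth_diff Uq.
have E2 w w' q j : U q -> 'D_w ('D_w' f) q 0 j = 'D_w ('D_w' (fun x => f x 0 j)) q.
  move=> Uq; rewrite -derive_entry; last exact: smooth_diff Uq.
  by apply: (open_eq_derive _ oU Uq) => x Ux; exact: E.
apply/rowP => j.
apply: (etrans (E2 v u p j Up) (etrans _ (esym (E2 u v p j Up)))).
have Cfj : smooth_on U (fun x => f x 0 j) by exact: (smooth_on_mxP f oU).1 Cf 0 j.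
have Cfj2 w : smooth_on U ('D_w (fun x => f x 0 j)) by exact: smooth_on_derive.
apply: (@derive_comm_scalar _ U) => //.
- by move=> q Uq; exact: smooth_diff Uq.
- by move=> w q Uq; apply: smooth_diff Uq.
- exact: (@smooth_on_derive _ _ _ _ _ v (Cfj2 u) 0%N p Up).
- exact: (@smooth_on_derive _ _ _ _ _ u (Cfj2 v) 0%N p Up).
Qed.
End Schwarz.

(** * The Nijenhuis tensor in a chart *)

Section Nijenhuis.

(** * Pointwise algebra of the Nijenhuis tensor *)

Section Torsion.
Context {R : comPzRingType}.
Implicit Types m n : nat.

(* The value at a point of [aJ, cJ] - [aJ, c]J - [a, cJ]J - [a, c], computed in
   a chart from the value j and the first-order derivatives dj of J. *)
Definition torsion m (j : 'M[R]_m) (dj : 'rV[R]_m -> 'M[R]_m) (a c : 'rV[R]_m)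
    : 'rV[R]_m :=
  c *m dj (a *m j) - a *m dj (c *m j) + a *m dj c *m j - c *m dj a *m j.

(** [da] and [dc] stand for the derivatives of two vector fields. All terms containing them cancel
    by [j *m j = - 1%:M]: this is the tensoriality of the Nijenhuis tensor. *)
Lemma torsion_product_rule m (j : 'M[R]_m) dj
    (a c : 'rV[R]_m) (da dc : 'rV[R]_m -> 'rV[R]_m) :
  j *m j = - 1%:M ->
  (dc (a *m j) *m j + c *m dj (a *m j)) - (da (c *m j) *m j + a *m dj (c *m j))
  - (dc (a *m j) - (da c *m j + a *m dj c)) *m j
  - ((dc a *m j + c *m dj a) - da (c *m j)) *m j
  - (dc a - da c) = torsion j dj a c.
Proof.
move=> jj; have jj1 (x : 'rV[R]_m) : x *m j *m j = - x by rewrite -mulmxA jj mulmxN mulmx1.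
rewrite /torsion !(mulmxDl, mulmxBl, mulNmx) !jj1.
move: (dc _ *m j) (da (_ *m _) *m j) (c *m _ *m j) (a *m _ *m j) => x1 x2 x3 x4.
move: (c *m dj _) (a *m dj _) (dc _) (da _) => x5 x6 x7 x8.
by apply/matrixP => i l; rewrite !mxE; ring.
Qed.

Lemma torsionC m (j : 'M[R]_m) dj a c : torsion j dj a c = - torsion j dj c a.
Proof.
rewrite /torsion.
move: (a *m _ *m j) (c *m _ *m j) (a *m dj _) (c *m dj _) => x y z t.
by apply/matrixP => i l; rewrite !mxE; ring.
Qed.

Lemma torsionDl m (j : 'M[R]_m) dj a b c :
  (forall u v, dj (u + v) = dj u + dj v) ->
  torsion j dj (a + b) c = torsion j dj a c + torsion j dj b c.
Proof.
move=> djD; rewrite /torsion !(mulmxDl, djD) !mulmxDr !mulmxDl.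
move: (c *m dj _) (c *m dj (b *m j)) (a *m dj _) (b *m dj _) => x1 x2 x3 x4.
move: (a *m dj c *m j) (b *m dj c *m j) (c *m dj a *m j) (c *m dj b *m j) => x5 x6 x7 x8.
by apply/matrixP => i l; rewrite !mxE; ring.
Qed.

(** [D] is the differential of a map and [dD] its derivative. The last hypothesis is
    [j *m D = D *m k] differentiated; it trades [dj] for [dk] and second derivatives of the map, and
    the latter cancel in pairs by their symmetry and [k *m k = - 1%:M]. *)
Lemma torsion_natural m n (j : 'M[R]_m) dj (k : 'M[R]_n) dk
    (D : 'M[R]_(m, n)) (dD : 'rV[R]_m -> 'M[R]_(m, n)) a c :
  k *m k = - 1%:M -> j *m D = D *m k ->
  (forall u v, u *m dD v = v *m dD u) ->
  (forall u, dj u *m D + j *m dD u = dD u *m k + D *m dk (u *m D)) ->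
  torsion j dj a c *m D = torsion k dk (a *m D) (c *m D).
Proof.
move=> kk jD dDC djD.
have jD1 (u : 'rV[R]_m) : u *m j *m D = u *m D *m k by rewrite -!mulmxA jD.
have kk1 (x : 'rV[R]_n) : x *m k *m k = - x by rewrite -mulmxA kk mulmxN mulmx1.
have djD1 (w u : 'rV[R]_m) : w *m dj u *m D =
    w *m dD u *m k + w *m D *m dk (u *m D) - w *m j *m dD u.
  by apply/eqP; rewrite eq_sym subr_eq -!mulmxA -!mulmxDr djD.
rewrite /torsion !(mulmxDl, mulmxBl, mulNmx) !jD1 !djD1 !jD1.
rewrite !(mulmxDl, mulmxBl, mulNmx) !kk1.
rewrite (dDC (c *m j) (a *m j)) (dDC c (a *m j)) (dDC (c *m j) a) (dDC c a).
move: (a *m D *m k) (c *m D *m k) => x y.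
move: (a *m D) (c *m D) => x' y'.
move: (a *m j *m dD c *m k) (a *m dD (c *m j) *m k) => z1 z2.
move: (a *m j *m dD (c *m j)) (a *m dD c) => z3 z4.
move: (x' *m dk y' *m k) (y' *m dk x' *m k) (x' *m dk y) (y' *m dk x) => z5 z6 z7 z8.
apply/matrixP => i l; rewrite !mxE; ring.
Qed.

End Torsion.

(** * The Nijenhuis tensor of a field of endomorphisms of coordinate space *)

Section Derivatives.
Context {R : realType}.

Definition nijenhuis m (J : 'rV[R]_m -> 'M[R]_m) p :=
  torsion (J p) (fun v => 'D_v J p).

Lemma derive_dirD m n k (J : 'rV[R]_m -> 'M[R]_(n, k)) p u v : differentiable J p ->
  'D_(u + v) J p = 'D_u J p + 'D_v J p.
Proof.
move=> dJ; apply: (etrans (deriveE _ dJ)); rewrite linearD.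
by apply: congr2; apply/esym/deriveE.
Qed.

Lemma nijenhuisC m (J : 'rV[R]_m -> 'M[R]_m) p a c :
  nijenhuis J p a c = - nijenhuis J p c a.
Proof. exact: torsionC. Qed.

Lemma nijenhuisDl m (J : 'rV[R]_m -> 'M[R]_m) p a b c : differentiable J p ->
  nijenhuis J p (a + b) c = nijenhuis J p a c + nijenhuis J p b c.
Proof. by move=> dJ; apply: torsionDl => u v; exact: derive_dirD. Qed.

Definition coord_bracket m (a c : 'rV[R]_m -> 'rV[R]_m) (p : 'rV[R]_m) :=
  'D_(a p) c p - 'D_(c p) a p.

Lemma nijenhuis_bracket m (J : 'rV[R]_m -> 'M[R]_m) (a c : 'rV[R]_m -> 'rV[R]_m) p :
  J p *m J p = - 1%:M -> differentiable J p ->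
  differentiable a p -> differentiable c p ->
  let aJ q := a q *m J q in let cJ q := c q *m J q in
  coord_bracket aJ cJ p - coord_bracket aJ c p *m J p
  - coord_bracket a cJ p *m J p - coord_bracket a c p = nijenhuis J p (a p) (c p).
Proof.
move=> JJ dJ da dc aJ cJ; rewrite /coord_bracket /nijenhuis.
have E (b : 'rV[R]_m -> 'rV[R]_m) v : differentiable b p ->
    'D_v (fun q => b q *m J q) p = 'D_v b p *m J p + b p *m 'D_v J p.
  by move=> db; exact: derive_mulmx.
have Ea v := E a v da; have Ec v := E c v dc.
rewrite -/aJ -/cJ in Ea Ec.
rewrite (Ec (aJ p)) (Ea (cJ p)) (Ea (c p)) (Ec (a p)).
exact: (torsion_product_rule (fun v => 'D_v J p) _ _
  (fun v => 'D_v a p) (fun v => 'D_v c p) JJ).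
Qed.

Lemma nijenhuis_natural m n (U : set 'rV[R]_m) (f : 'rV[R]_m -> 'rV[R]_n)
    (J : 'rV[R]_m -> 'M[R]_m) (K : 'rV[R]_n -> 'M[R]_n) p a c :
  open U -> U p -> smooth_on U f ->
  (forall q, U q -> J q *m jacobian f q = jacobian f q *m K (f q)) ->
  differentiable J p -> differentiable K (f p) -> K (f p) *m K (f p) = - 1%:M ->
  nijenhuis J p a c *m jacobian f p
  = nijenhuis K (f p) (a *m jacobian f p) (c *m jacobian f p).
Proof.
move=> oU Up Cf JD dJ dK KK.
have df : differentiable f p by exact: smooth_diff Up.
have dD : differentiable (jacobian f) p.
  by apply: smooth_diff Up; exact: smooth_on_jacobian.
(* Contracting with a constant [u] turns the derivative of the Jacobian into an iterated directional
   derivative, to which the symmetry of second derivatives applies. *)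
have DDE u v : u *m 'D_v (jacobian f) p = 'D_v ('D_u f) p.
  have dc : differentiable (fun _ : 'rV[R]_m => u) p by exact: differentiable_cst.
  have := derive_mulmx v dc dD; rewrite derive_cst mul0mx add0r => <-.
  apply: (open_eq_derive _ oU Up) => q Uq.
  by rewrite deriveEjacobian //; exact: smooth_diff Uq.
have DDC u v : u *m 'D_v (jacobian f) p = v *m 'D_u (jacobian f) p.
  by apply: (etrans (DDE u v) (etrans _ (esym (DDE v u)))); exact: derive_comm oU Up Cf.
have dKf : differentiable (K \o f) p by exact: differentiable_comp.
have DKf v : 'D_v (K \o f) p = 'D_(v *m jacobian f p) K (f p).
  by apply: (etrans (derive_comp_rV _ df dK)); rewrite (deriveEjacobian _ df).
apply: (torsion_natural (dD := fun v => 'D_v (jacobian f) p)) => //.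
- exact: JD.
move=> u; have E1 := derive_mulmx u dJ dD; have E2 := derive_mulmx u dD dKf.
rewrite -DKf; apply: (etrans (esym E1) (etrans _ E2)).
exact: (open_eq_derive _ oU Up).
Qed.

End Derivatives.
End Nijenhuis.

(** * Charts and fields *)

Section Charts.
Context {R : realType}.

Lemma mulmx_ext (K : pzSemiRingType) a b (A B : 'M[K]_(a, b)) :
  (forall u : 'rV[K]_a, u *m A = u *m B) -> A = B.
Proof. by move=> AB; apply/row_matrixP => i; rewrite !rowE. Qed.

Lemma mulmx_cancel (K : pzSemiRingType) a b c d (X : 'M[K]_(a, b)) (P Q : 'M[K]_b)
    (C : 'M[K]_(b, c)) (S : 'M[K]_(c, d)) :
  P *m Q = 1%:M -> X *m P *m (Q *m C *m S) = X *m C *m S.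
Proof. by move=> PQ; rewrite !mulmxA -(mulmxA X P) PQ mulmx1. Qed.

Lemma jacobian_comp m n l (g : 'rV[R]_n -> 'rV[R]_l) (f : 'rV[R]_m -> 'rV[R]_n) p :
  differentiable f p -> differentiable g (f p) ->
  jacobian (g \o f) p = jacobian f p *m jacobian g (f p).
Proof.
move=> df dg; have dgf : differentiable (g \o f) p by exact: differentiable_comp.
apply: mulmx_ext => u; rewrite mulmxA -(deriveEjacobian u df).
apply: (etrans (esym (deriveEjacobian u dgf)) (etrans _ (deriveEjacobian _ dg))).
exact: derive_comp_rV.
Qed.

Lemma open_eq_jacobian m n (U : set 'rV[R]_m) (f g : 'rV[R]_m -> 'rV[R]_n) p :
  open U -> U p -> (forall q, U q -> f q = g q) -> differentiable f p ->
  jacobian f p = jacobian g p.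
Proof.
move=> oU Up fg df.
have dg : differentiable g p.
  by apply: near_eq_differentiable df; exact: open_near_eq Up fg.
apply: mulmx_ext => u.
apply: (etrans (esym (deriveEjacobian u df)) (etrans _ (deriveEjacobian u dg))).
exact: (open_eq_derive u oU Up fg).
Qed.

Lemma jacobian_id m p : jacobian (id : 'rV[R]_m -> 'rV[R]_m) p = 1%:M.
Proof.
have d : differentiable (id : 'rV[R]_m -> 'rV[R]_m) p by [].
apply: mulmx_ext => u; rewrite mulmx1 -(deriveEjacobian u d); exact: derive_id.
Qed.

Section Chart.
Context {m : nat} {T : topologicalType}.
Implicit Types (c : chart R m T).

Lemma cdom_open c : open (cdom c). Proof. by case: c. Qed.
Lemma cmapK c x : cdom c x -> cinv c (cmap c x) = x.
Proof. by case: c x => ? ? ? /= _ _ + _ _ x; apply. Qed.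

(** Inside the open image of the chart, [cimg c U] is a preimage under [cinv c], which is continuous
    there. *)
Lemma cimg_open c (U : set T) : open U -> open (cimg c U).
Proof.
move=> oU.
have -> : cimg c U = (cmap c @` cdom c) `&` cinv c @^-1` U.
  rewrite /cimg eqEsubset; split=> p.
    by move=> [x [Ux dx] <-]; split; [exists x|rewrite /= cmapK].
  by move=> [[x dx <-]]; rewrite /= cmapK // => Ux; exists x.
have [oi ci] : open (cmap c @` cdom c) /\
    (forall p, (cmap c @` cdom c) p -> {for p, continuous (cinv c)}).
  by case: c.
rewrite openE => p [ip Up]; apply: filterI; first exact: open_nbhs_nbhs.
by apply: (ci p ip); exact: open_nbhs_nbhs.
Qed.

Lemma cimg_map c (U : set T) x : U x -> cdom c x -> cimg c U (cmap c x).
Proof. by move=> Ux dx; exists x. Qed.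

Lemma cimg_subset c (U U' : set T) : U `<=` U' -> cimg c U `<=` cimg c U'.
Proof. by move=> s p [x [/s Ux dx] <-]; exists x. Qed.
End Chart.

Lemma smooth_on_subset (V W : normedModType R) (U U' : set V) (f : V -> W) :
  U' `<=` U -> smooth_on U f -> smooth_on U' f.
Proof. by move=> s Cf k; exact: Ck_on_subset (Cf k). Qed.

Section Manifold.
Context {m : nat} {M : smoothManifold R m}.
Implicit Types (c : chart R m M) (x : M).

Lemma chart_atlas x : atlas (chart_at x). Proof. by case: (chart_atP x). Qed.
Lemma chart_dom x : cdom (chart_at x) x. Proof. by case: (chart_atP x). Qed.
Hint Resolve chart_atlas chart_dom : core.

Lemma trans_smooth c c' : atlas c -> atlas c' ->
  smooth_on (cimg c (cdom c')) (cmap c' \o cinv c).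
Proof. by case: M c c'. Qed.

Lemma trans_differentiable c c' x : atlas c -> atlas c' -> cdom c x -> cdom c' x ->
  differentiable (cmap c' \o cinv c) (cmap c x).
Proof.
move=> Ac Ac' dx dx'; apply: smooth_diff (trans_smooth Ac Ac') _.
exact: cimg_map.
Qed.

Lemma dtrans_id c x : cdom c x -> dtrans c c x = 1%:M.
Proof.
move=> dx; rewrite -(jacobian_id (cmap c x)) /dtrans; apply/esym.
apply: (open_eq_jacobian (U := cimg c setT)) => //.
- exact/cimg_open/openT.
- exact: cimg_map.
- by move=> _ [y [_ dy] <-]; rewrite /= cmapK.
Qed.

Lemma dtrans_comp c c' c'' x : atlas c -> atlas c' -> atlas c'' ->
  cdom c x -> cdom c' x -> cdom c'' x ->
  dtrans c c' x *m dtrans c' c'' x = dtrans c c'' x.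
Proof.
move=> A A' A'' d d' d''; rewrite /dtrans.
have d1 := trans_differentiable A A' d d'.
have d2 := trans_differentiable A' A'' d' d''.
have E : (cmap c' \o cinv c) (cmap c x) = cmap c' x by rewrite /= cmapK.
rewrite -E in d2; rewrite -[X in jacobian (_ \o cinv c') X]E.
rewrite -(jacobian_comp d1 d2); apply: (open_eq_jacobian (U := cimg c (cdom c'))).
- exact/cimg_open/cdom_open.
- exact: cimg_map.
- by move=> _ [y [d'y dy] <-]; rewrite /= cmapK // cmapK.
- exact: differentiable_comp.
Qed.

Lemma dtransK c c' x : atlas c -> atlas c' -> cdom c x -> cdom c' x ->
  dtrans c c' x *m dtrans c' c x = 1%:M.
Proof. by move=> *; rewrite dtrans_comp // dtrans_id. Qed.

Lemma field_inE c X x : cdom c x ->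
  field_in c X (cmap c x) = X x *m dtrans (chart_at x) c x.
Proof. by move=> dx; rewrite /field_in cmapK. Qed.

Lemma endo_inE c A x : cdom c x ->
  endo_in c A (cmap c x) = dtrans c (chart_at x) x *m A x *m dtrans (chart_at x) c x.
Proof. by move=> dx; rewrite /endo_in cmapK. Qed.

Lemma field_in_pt X x : field_in (chart_at x) X (pt x) = X x.
Proof. by rewrite field_inE // dtrans_id // mulmx1. Qed.

Lemma endo_in_pt A x : endo_in (chart_at x) A (pt x) = A x.
Proof. by rewrite endo_inE // dtrans_id // mulmx1 mul1mx. Qed.

Lemma field_in_mul c X A p : atlas c -> cimg c setT p ->
  field_in c (fun y => X y *m A y) p = field_in c X p *m endo_in c A p.
Proof.
move=> Ac [x [_ dx] <-].
rewrite field_inE // field_inE // endo_inE //.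
by apply/esym/mulmx_cancel; exact: dtransK.
Qed.

Lemma endo_in_sqr c A p : atlas c -> cimg c setT p ->
  (forall x, A x *m A x = - 1%:M) -> endo_in c A p *m endo_in c A p = - 1%:M.
Proof.
move=> Ac [x [_ dx] <-] AA; rewrite endo_inE //.
apply: (etrans (mulmx_cancel _ _ _ (dtransK _ _ _ _))) => //.
rewrite -(mulmxA _ (A x) (A x)) AA mulmxN mulmx1 mulNmx; congr (- _); exact: dtransK.
Qed.

Lemma smooth_field_mul (U : set M) X A : open U ->
  smooth_field U X -> smooth_endo A -> smooth_field U (fun y => X y *m A y).
Proof.
move=> oU CX CA c Ac; have oc : open (cimg c U) by exact: cimg_open.
apply: (@smooth_on_eq _ _ _ oc _ (fun p => field_in c X p *m endo_in c A p)).
  move=> p cp; rewrite field_in_mul //.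
  exact: cimg_subset cp.
apply: smooth_on_mulmx => //; first exact: CX.
by apply: smooth_on_subset (CA c Ac); exact: cimg_subset.
Qed.

(** Meaningful on [cdom c] only. It supplies the real fields behind all test sections: with constant
    [F] for integrability and superminimality, with a suitable [F] for horizontal sections. *)
Definition chart_field c (F : 'rV[R]_m -> 'rV[R]_m) x : 'rV[R]_m :=
  F (cmap c x) *m dtrans c (chart_at x) x.

Lemma field_in_chart_field c F p : atlas c -> cimg c setT p ->
  field_in c (chart_field c F) p = F p.
Proof.
move=> Ac [x [_ dx] <-]; apply: (etrans (field_inE _ dx)); rewrite /chart_field -mulmxA.
by have -> := dtransK Ac (chart_atlas x) dx (chart_dom x); rewrite mulmx1.
Qed.

Lemma smooth_chart_field (U : set M) c F : open U -> U `<=` cdom c -> atlas c ->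
  smooth_on (cimg c U) F -> smooth_field U (chart_field c F).
Proof.
move=> oU sU Ac CF c' Ac'.
have oc' : open (cimg c' U) by exact: cimg_open.
have oc : open (cimg c U) by exact: cimg_open.
pose t := cmap c \o cinv c'; pose s := cmap c' \o cinv c.
have ct : smooth_on (cimg c' U) t.
  by apply: smooth_on_subset (trans_smooth Ac' Ac); exact: cimg_subset.
have tU p : cimg c' U p -> (cimg c U `&` cimg c (cdom c')) (t p).
  move=> [x [Ux d'x] <-]; rewrite /t /= cmapK //.
  by split; exists x => //; split=> //; exact: sU.
have oo : open (cimg c (cdom c')) by exact/cimg_open/cdom_open.
(* In the chart [c'] the field is [F] after the transition [t] to [c], carried back by the Jacobian
   of the opposite transition [s]. *)
apply: (@smooth_on_eq _ _ _ oc' _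
   (fun p => (F \o t) p *m (jacobian s \o t) p)).
  move=> _ [x [Ux d'x] <-]; have dx := sU _ Ux.
  apply: (etrans _ (esym (field_inE _ d'x))); rewrite /chart_field -mulmxA.
  have -> := dtrans_comp Ac (chart_atlas x) Ac' dx (chart_dom x) d'x.
  by rewrite /t /= cmapK.
apply: smooth_on_mulmx => //.
  by apply: (smooth_on_comp oc' oc _ CF ct) => p /tU [].
apply: (smooth_on_comp oc' oo _ _ ct) => [p /tU []//|].
apply: smooth_on_jacobian => //; exact: trans_smooth.
Qed.

Lemma field_in_diff (U : set M) X x : open U -> smooth_field U X -> U x ->
  differentiable (field_in (chart_at x) X) (pt x).
Proof.
move=> oU CX Ux; apply: smooth_diff (CX _ (chart_atlas x)) _.
exact: cimg_map.
Qed.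

Lemma endo_in_diff A x : smooth_endo A ->
  differentiable (endo_in (chart_at x) A) (pt x).
Proof.
move=> CA; apply: smooth_diff (CA _ (chart_atlas x)) _.
exact: cimg_map.
Qed.

End Manifold.
End Charts.

(** * Sections of the holomorphic tangent bundle and the Nijenhuis tensor *)

Section AlmostComplex.
Context {R : realType}.

Lemma cplxM a b c (A : 'M[R]_(a, b)) (B : 'M[R]_(b, c)) :
  cplx (A *m B) = cplx A *m cplx B.
Proof. exact: map_mxM. Qed.

Lemma re_cplx a b (A B : 'M[R]_(a, b)) :
  map_mx (@complex.Re R) (cplx A + 'i%C *: cplx B) = A.
Proof. apply/matrixP => i j; rewrite !mxE /=; ring. Qed.

Lemma im_cplx a b (A B : 'M[R]_(a, b)) :
  map_mx (@complex.Im R) (cplx A + 'i%C *: cplx B) = B.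
Proof. apply/matrixP => i j; rewrite !mxE /=; ring. Qed.

Lemma cplx_re_im a b (Z : 'M[R[i]]_(a, b)) :
  Z = cplx (map_mx (@complex.Re R) Z) + 'i%C *: cplx (map_mx (@complex.Im R) Z).
Proof.
apply/matrixP => i j; rewrite !mxE; case: (Z i j) => x y /=.
by apply/eqP; rewrite eq_complex /=; apply/andP; split; apply/eqP; ring.
Qed.

Lemma cplx_inj2 a b (A B A' B' : 'M[R]_(a, b)) :
  cplx A + 'i%C *: cplx B = cplx A' + 'i%C *: cplx B' -> A = A' /\ B = B'.
Proof.
by move=> E; split; [rewrite -(re_cplx A B) E re_cplx|rewrite -(im_cplx A B) E im_cplx].
Qed.

Lemma i_cplx a b (A B : 'M[R]_(a, b)) :
  'i%C *: (cplx A + 'i%C *: cplx B) = cplx (- B) + 'i%C *: cplx A.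
Proof.
apply/matrixP => i j; rewrite !mxE.
by apply/eqP; rewrite eq_complex /=; apply/andP; split; apply/eqP; ring.
Qed.

Lemma cplx_mulr a b c (A B : 'M[R]_(a, b)) (C : 'M[R]_(b, c)) :
  (cplx A + 'i%C *: cplx B) *m cplx C = cplx (A *m C) + 'i%C *: cplx (B *m C).
Proof. by rewrite mulmxDl -scalemxAl !cplxM. Qed.

Lemma cplx_submx a b c (A B : 'M[R]_(a, b)) (C : 'M[R]_(c, b)) :
  (A <= C)%MS -> (B <= C)%MS -> ((cplx A + 'i%C *: cplx B)%R <= cplx C)%MS.
Proof.
move=> /submxP[a' ->] /submxP[b' ->].
by rewrite !cplxM scalemxAl -mulmxDl; exact: submxMl.
Qed.

Section Manifold.
Context {m : nat} {M : almostHermitian R m}.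
Implicit Types (x : M).

Lemma acs_sqr x : acs x *m acs x = - 1%:M.
Proof. by move: x; case: M. Qed.

Lemma acs_smooth : smooth_endo (@acs R m M).
Proof. by case: M. Qed.

Lemma acs_isometry x : acs x *m metric x *m (acs x)^T = metric x.
Proof. by move: x; case: M. Qed.

Lemma acsK x n (u : 'M[R]_(n, m)) : u *m acs x *m acs x = - u.
Proof. by rewrite -mulmxA acs_sqr mulmxN mulmx1. Qed.

(** A (1,0)-vector is a - iJa, hence determined by its real part; this brings complex sections down
    to real fields. *)
Lemma T10P x (a b : 'rV[R]_m) :
  T10 x (cplx a + 'i%C *: cplx b) <-> b = - (a *m acs x).
Proof.
rewrite /T10 cplx_mulr i_cplx; split=> [/cplx_inj2[-> _]|->].
  by rewrite opprK.
by rewrite opprK mulNmx acsK opprK.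
Qed.

Lemma T10_im x (z : 'rV[R[i]]_m) : T10 x z ->
  map_mx (@complex.Im R) z = - (map_mx (@complex.Re R) z *m acs x).
Proof. by rewrite {1}(cplx_re_im z) => /T10P. Qed.

Definition nij x (a c : 'rV[R]_m) : 'rV[R]_m :=
  nijenhuis (endo_in (chart_at x) (@acs R m M)) (pt x) a c.

Lemma bracketE (X Y : M -> 'rV[R]_m) x :
  bracket X Y x =
    coord_bracket (field_in (chart_at x) X) (field_in (chart_at x) Y) (pt x).
Proof. by rewrite /coord_bracket !field_in_pt. Qed.

(** With k1 = [a,c], k4 = [Ja,Jc] and k2, k3 the two mixed brackets, the bracket of a - iJa and c -
    iJc is (k1 - k4) + i(- k3 - k2); the left-hand side is its failure to be of type (1,0). *)
Lemma bracket_algebra (j : 'M[R]_m) (k1 k2 k3 k4 N : 'rV[R]_m) :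
  j *m j = - 1%:M -> k4 - k2 *m j - k3 *m j - k1 = N ->
  (k1 - k4) *m j + (- k3 - k2) = - N *m j.
Proof.
move=> jj <-; rewrite !(mulmxBl, mulNmx) -!mulmxA jj !mulmxN !mulmx1.
move: (k1 *m j) (k4 *m j) => x y; apply/rowP => i; rewrite !mxE; ring.
Qed.

Lemma coord_bracket_eq (U : set 'rV[R]_m) (a a' c c' : 'rV[R]_m -> 'rV[R]_m) p :
  open U -> U p -> (forall q, U q -> a q = a' q) -> (forall q, U q -> c q = c' q) ->
  coord_bracket a c p = coord_bracket a' c' p.
Proof.
move=> oU Up aa cc; rewrite /coord_bracket (aa _ Up) (cc _ Up).
exact: (congr2 (fun u v => u - v)
  (open_eq_derive _ oU Up cc) (open_eq_derive _ oU Up aa)).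
Qed.

Lemma coord_bracketNl (a c : 'rV[R]_m -> 'rV[R]_m) p :
  differentiable a p -> differentiable c p ->
  coord_bracket (fun q => - a q) c p = - coord_bracket a c p.
Proof.
move=> da dc; rewrite /coord_bracket opprB.
have E1 : 'D_(- a p) c p = - 'D_(a p) c p.
  by apply: (etrans (deriveE _ dc)); rewrite linearN; congr (- _); apply/esym/deriveE.
have E2 : 'D_(c p) (fun q => - a q) p = - 'D_(c p) a p.
  exact: (deriveN (diff_derivable da)).
by apply: (etrans (congr2 (fun u v => u - v) E1 E2)); rewrite opprK addrC.
Qed.

Lemma coord_bracketC (a c : 'rV[R]_m -> 'rV[R]_m) p :
  coord_bracket a c p = - coord_bracket c a p.
Proof. by rewrite /coord_bracket opprB. Qed.

Lemma coord_bracketNr (a c : 'rV[R]_m -> 'rV[R]_m) p :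
  differentiable a p -> differentiable c p ->
  coord_bracket a (fun q => - c q) p = - coord_bracket a c p.
Proof.
move=> da dc; apply: (etrans (coord_bracketC _ _ _)); congr (- _).
by apply: (etrans (coord_bracketNl dc da)); apply/esym/coord_bracketC.
Qed.

(** By [T10P], [P *m acs x + Q] vanishes exactly when the bracket is of type (1,0). The identity
    serves in both directions between integrability and the vanishing of [nij], and once more, after
    vertical projection, to exploit (ii). *)
Lemma cbracket_T10_sections (U : set M) (Z W : M -> 'rV[R[i]]_m) x :
  open U -> smooth_cfield U Z -> smooth_cfield U W ->
  (forall y, U y -> T10 y (Z y)) -> (forall y, U y -> T10 y (W y)) -> U x ->
  exists P Q, cbracket Z W x = cplx P + 'i%C *: cplx Q /\
    P *m acs x + Q = - nij x (re_field Z x) (re_field W x) *m acs x.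
Proof.
move=> oU [CA CB] [CC CE] TZ TW Ux.
set A := re_field Z in CA *; set C := re_field W in CC *.
have BE y : U y -> im_field Z y = - (A y *m acs y) by move=> /TZ/T10_im.
have EE y : U y -> im_field W y = - (C y *m acs y) by move=> /TW/T10_im.
rewrite /cbracket; do 2 eexists; split; first by [].
pose c := chart_at x; pose a := field_in c A; pose d := field_in c C.
pose j := endo_in c (@acs R m M); pose p := pt x.
have da : differentiable a p by exact: field_in_diff CA Ux.
have dd : differentiable d p by exact: field_in_diff CC Ux.
have dj : differentiable j p by exact/endo_in_diff/acs_smooth.
have daj : differentiable (fun q => a q *m j q) p by exact: differentiable_mulmx.
have ddj : differentiable (fun q => d q *m j q) p by exact: differentiable_mulmx.
have oc : open (cimg c U) by exact: cimg_open.
have cp : cimg c U p by apply: cimg_map Ux _; exact: chart_dom.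
have aj (X : M -> 'rV[R]_m) Y : (forall y, U y -> Y y = - (X y *m acs y)) ->
    forall q, cimg c U q -> field_in c Y q = - (field_in c X q *m j q).
  move=> XY q Uq; rewrite -field_in_mul; last 2 first.
  - exact: chart_atlas.
  - exact: cimg_subset Uq.
  case: Uq => y [Uy cy] <-.
  apply: (etrans (field_inE _ cy)); rewrite (XY y Uy) mulNmx.
  exact: (congr1 (fun u => - u) (esym (field_inE (fun y => X y *m acs y) cy))).
have b1 : bracket (im_field Z) (im_field W) x
    = coord_bracket (fun q => a q *m j q) (fun q => d q *m j q) p.
  rewrite bracketE; apply: (etrans (coord_bracket_eq oc cp (aj _ _ BE) (aj _ _ EE))).
  apply: (etrans (coord_bracketNl daj _)); first exact: differentiableN.
  by rewrite coord_bracketNr // opprK.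
have rfl (f : 'rV[R]_m -> 'rV[R]_m) q : cimg c U q -> f q = f q by [].
have b2 : bracket A (im_field W) x = - coord_bracket a (fun q => d q *m j q) p.
  rewrite bracketE; apply: (etrans (coord_bracket_eq oc cp (rfl a) (aj _ _ EE))).
  exact: coord_bracketNr.
have b3 : bracket (im_field Z) C x = - coord_bracket (fun q => a q *m j q) d p.
  rewrite bracketE; apply: (etrans (coord_bracket_eq oc cp (aj _ _ BE) (rfl d))).
  exact: coord_bracketNl.
have b4 : bracket A C x = coord_bracket a d p by exact: bracketE.
have jj : j p *m j p = - 1%:M by rewrite /j /p endo_in_pt acs_sqr.
have ap : a p = A x by exact: field_in_pt.
have dp : d p = C x by exact: field_in_pt.
have jp : j p = acs x by exact: endo_in_pt.
have := nijenhuis_bracket jj dj da dd; rewrite /= ap dp jp.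
rewrite -/(nij x (A x) (C x)) => NE.
move: (coord_bracket _ _ p) (coord_bracket _ _ p) (coord_bracket _ _ p)
  (coord_bracket _ _ p) b1 b2 b3 b4 NE => k1 k2 k3 k4 b1 b2 b3 b4 NE.
rewrite -/A -/C b1 b2 b3 b4; exact: bracket_algebra (acs_sqr x) NE.
Qed.

End Manifold.
End AlmostComplex.

(** * Integrability as vanishing of the Nijenhuis tensor *)

Section Integrability.
Context {R : realType} {m : nat} {M : almostHermitian R m}.
Implicit Types (x : M).

Definition field10 (X : M -> 'rV[R]_m) x : 'rV[R[i]]_m :=
  cplx (X x) + 'i%C *: cplx (- (X x *m acs x)).

Lemma T10_field10 X x : T10 x (field10 X x).
Proof. exact/T10P. Qed.

Lemma re_field10 X : re_field (field10 X) = X.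
Proof. by apply/funext => x; exact: re_cplx. Qed.

Lemma smooth_fieldN (U : set M) (X : M -> 'rV[R]_m) : open U ->
  smooth_field U X -> smooth_field U (fun y => - X y).
Proof.
move=> oU CX c Ac.
have oc : open (cimg c U) by exact: cimg_open.
have := smooth_onN oc (CX c Ac).
by apply: (smooth_on_eq oc) => q _; rewrite /field_in mulNmx.
Qed.

Lemma smooth_field10 (U : set M) (X : M -> 'rV[R]_m) : open U ->
  smooth_field U X -> smooth_cfield U (field10 X).
Proof.
move=> oU CX; split; first by rewrite re_field10.
have -> : im_field (field10 X) = fun x => - (X x *m acs x).
  by apply/funext => x; exact: im_cplx.
apply: smooth_fieldN => //.
by apply: smooth_field_mul => //; exact: acs_smooth.
Qed.

Lemma chart_field_at x (F : 'rV[R]_m -> 'rV[R]_m) :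
  chart_field (chart_at x) F x = F (pt x).
Proof.
by rewrite /chart_field dtrans_id ?mulmx1 //; exact: chart_dom.
Qed.

Lemma acs_inj x (u : 'rV[R]_m) : u *m acs x = 0 -> u = 0.
Proof.
by move=> u0; apply/eqP; rewrite -oppr_eq0 -(acsK x) u0 mul0mx.
Qed.

Lemma nij0_integrable : (forall x a c, nij x a c = 0) -> integrable_acs M.
Proof.
move=> N0 U Z W oU CZ CW TZ TW x Ux.
have [P [Q [-> E]]] := cbracket_T10_sections oU CZ CW TZ TW Ux.
apply/T10P; apply/eqP; rewrite -addr_eq0 addrC E N0 oppr0 mul0mx; exact: eqxx.
Qed.

Lemma constant_field_smooth x (a : 'rV[R]_m) :
  smooth_field (cdom (chart_at x)) (chart_field (chart_at x) (fun=> a)).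
Proof.
apply: smooth_chart_field => //.
- exact: cdom_open.
- exact: chart_atlas.
- exact: smooth_on_cst.
Qed.

(** Any two tangent vectors at [x] extend to fields with constant components in the chart, whose
    (1,0)-parts are admissible test sections. *)
Lemma integrable_nij0 : integrable_acs M -> forall x a c, nij x a c = 0.
Proof.
move=> HM x a c; pose X b : M -> 'rV[R]_m := chart_field (chart_at x) (fun=> b).
have od := cdom_open (chart_at x); have dx := chart_dom x.
have CX b : smooth_cfield (cdom (chart_at x)) (field10 (X b)).
  by apply: smooth_field10 => //; exact: constant_field_smooth.
have T b y : cdom (chart_at x) y -> T10 y (field10 (X b) y).
  by move=> _; exact: T10_field10.
have [P [Q [PQ E]]] := cbracket_T10_sections od (CX a) (CX c) (T a) (T c) dx.
have := HM _ _ _ od (CX a) (CX c) (T a) (T c) x dx.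
rewrite PQ => /T10P QP; move: E; rewrite !re_field10 /X !chart_field_at.
rewrite QP subrr => /esym /acs_inj /eqP; rewrite oppr_eq0; exact: eqP.
Qed.

End Integrability.

(** * Pointwise consequences of superminimality *)

Section Superminimal.
Context {R : realFieldType} {m : nat}.

(** A relation [v *m j = c *: v] would give [c * c = -1] over an ordered field, so [v] and [v *m j]
    are independent and exhaust a space of rank 2. *)
Lemma complex_line_sub (j V : 'M[R]_m) (v w : 'rV[R]_m) :
  j *m j = - 1%:M -> \rank V = 2%N -> (V *m j <= V)%MS ->
  (v <= V)%MS -> (w <= V)%MS -> v != 0 ->
  exists a b, w = a *: v + b *: (v *m j).
Proof.
move=> jj rV Vj vV wV v0.
have vjV : (v *m j <= V)%MS by apply: submx_trans Vj; exact: submxMr.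
have sV : (v + v *m j <= V)%MS by rewrite addsmx_sub vV.
have lt : (v < v + v *m j)%MS.
  rewrite /ltmx addsmxSl; apply/negP; rewrite addsmx_sub => /andP[_].
  case/sub_rVP => c vc; have E : v *m j *m j = (c * c) *: v.
    by rewrite {1}vc -scalemxAl vc scalerA.
  move: E; rewrite -mulmxA jj mulmxN mulmx1 => /eqP.
  rewrite eq_sym -addr_eq0 -[X in _ + X]scale1r -scalerDl scaler_eq0 (negPf v0) orbF.
  by rewrite gt_eqF // ltr_wpDl // -expr2 sqr_ge0.
have r2 : (2 <= \rank (v + v *m j)%MS)%N.
  move: lt; rewrite ltmxErank rank_rV v0 => /andP[_]; exact.
have Vs : (V <= v + v *m j)%MS.
  rewrite -(geq_leqif (mxrank_leqif_sup sV)) rV //.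
have /sub_addsmxP [u ->] := submx_trans wV Vs.
exists (u.1 0 0), (u.2 0 0).
by rewrite {1}(mx11_scalar u.1) {1}(mx11_scalar u.2) !mul_scalar_mx.
Qed.

(** Data at one point: [dj u] and [dm u] are the derivatives of J and of the metric along [u], and
    [gam] is the Christoffel form. [gamC] is torsion-freeness, [dm_gam] metric compatibility; [dm_j]
    and [djj] are the derivatives of the isometry condition and of J^2 = -1. *)
Context (g j : 'M[R]_m) (dj : 'rV[R]_m -> 'M[R]_m)
  (gam : 'rV[R]_m -> 'rV[R]_m -> 'rV[R]_m) (dm : 'rV[R]_m -> 'rV[R]_m -> 'rV[R]_m -> R).
Local Notation ip u v := (((u *m g *m v^T) 0 0) : R).
Implicit Types u v w a b c : 'rV[R]_m.
Hypothesis gT : g^T = g.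
Hypothesis jj : j *m j = - 1%:M.
Hypothesis jg : j *m g *m j^T = g.
Hypothesis gamC : forall u v, gam u v = gam v u.
Hypothesis gamN : forall u v, gam u (- v) = - gam u v.
Hypothesis dm_gam : forall u v w, dm u v w = ip (gam u v) w + ip v (gam u w).
Hypothesis dm_j : forall u v w,
  dm u (v *m j) (w *m j) + ip (v *m dj u) (w *m j) + ip (v *m j) (w *m dj u) = dm u v w.
Hypothesis djj : forall u, dj u *m j + j *m dj u = 0.

(* The covariant derivative of the almost complex structure: (nabla_u J) a. *)
Let K u a : 'rV[R]_m := a *m dj u + gam u (a *m j) - gam u a *m j.

Let j1 (u : 'rV[R]_m) : u *m j *m j = - u.
Proof. by rewrite -mulmxA jj mulmxN mulmx1. Qed.

Let ipC u v : ip u v = ip v u.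
Proof.
have -> : u *m g *m v^T = (v *m g *m u^T)^T by rewrite !trmx_mul trmxK gT mulmxA.
by rewrite mxE.
Qed.

Let ipDl u v w : ip (u + v) w = ip u w + ip v w.
Proof. by rewrite !mulmxDl mxE. Qed.
Let ipNl u w : ip (- u) w = - ip u w.
Proof. by rewrite !mulNmx mxE. Qed.
Let ipDr u v w : ip w (u + v) = ip w u + ip w v.
Proof. by rewrite (ipC w (u + v)) ipDl !(ipC w). Qed.
Let ipNr u w : ip w (- u) = - ip w u.
Proof. by rewrite (ipC w (- u)) ipNl (ipC w). Qed.
Let ipZr (x : R) u w : ip w (x *: u) = x * ip w u.
Proof. by rewrite linearZ /= -scalemxAr mxE. Qed.
Let ipj u v : ip (u *m j) (v *m j) = ip u v.
Proof. by rewrite trmx_mul !mulmxA -(mulmxA _ j) -(mulmxA _ (j *m g)) jg. Qed.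

(** The covariant derivative of g(Ja,Jb) = g(a,b), in which metric compatibility absorbs the
    derivatives of g. *)
Let K_skew u a b : ip (K u a) (b *m j) + ip (a *m j) (K u b) = 0.
Proof.
rewrite /K !(ipDl, ipNl, ipDr, ipNr) !ipj.
have := dm_j u a b; rewrite !dm_gam.
set x1 := ip (gam u _) _; set x2 := ip _ (gam u _); set x3 := ip (a *m dj u) _.
set x4 := ip _ (b *m dj u); set x5 := ip (gam u _) _; set x6 := ip _ (gam u b).
by lra.
Qed.

Let KJ u a : K u (a *m j) = - (K u a *m j).
Proof.
have E : a *m dj u *m j = - (a *m j *m dj u).
  by apply/eqP; rewrite -addr_eq0 -!mulmxA -mulmxDr djj mulmx0.
rewrite /K !(mulmxDl, mulNmx) !j1 gamN E.
move: (gam _ _) (gam _ _ *m j) (_ *m dj u) => x y z.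
by apply/matrixP => i k; rewrite !mxE; ring.
Qed.

(** [K_skew] on the pair [v], [v] gives orthogonality to [v *m j]; on the pair [v], [v *m j],
    combined with [KJ], it gives orthogonality to [v]. *)
Let K_orth u v : ip (K u v) v = 0 /\ ip (K u v) (v *m j) = 0.
Proof.
split; last by have := K_skew u v v; rewrite (ipC _ (K u v)); lra.
have := K_skew u v (v *m j); rewrite KJ j1 !ipNr ipj (ipC v); lra.
Qed.

(** Because the connection is torsion-free, covariant derivatives of J may replace ordinary ones:
    the [gam] terms cancel by symmetry. *)
Let torsionE a c :
  torsion j dj a c = K (a *m j) c - K (c *m j) a + K c a *m j - K a c *m j.
Proof.
rewrite /torsion /K !(mulmxDl, mulmxBl, mulNmx) !j1.
rewrite (gamC (c *m j) (a *m j)) (gamC (c *m j) a) (gamC c (a *m j)) (gamC c a).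
move: (gam _ _) (gam _ _ *m j) (gam _ _ *m j) (gam _ _) => x y z t.
move: (c *m dj (_ *m j)) (a *m dj (_ *m j)) (a *m dj c *m j) (c *m dj a *m j) => x' y' z' t'.
by apply/matrixP => i k; rewrite !mxE; ring.
Qed.

Lemma torsion_superminimal (V : 'M[R]_m) a v w :
  \rank V = 2%N -> (V *m j <= V)%MS ->
  (forall v a, (v <= V)%MS ->
     a *m dj v + gam v (a *m j) = gam v a *m j) ->
  (v <= V)%MS -> (w <= V)%MS -> ip (torsion j dj a v) w = 0.
Proof.
move=> rV Vj KV vV wV.
have KV0 y b : (y <= V)%MS -> K y b = 0.
  by move=> yV; rewrite /K KV // subrr.
have vjV : (v *m j <= V)%MS by apply: submx_trans Vj; exact: submxMr.
rewrite torsionE (KV0 _ _ vjV) (KV0 _ _ vV) mul0mx addr0 subr0.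
(* The zero vector spans nothing and is treated apart. Since [gam u] is only assumed odd,
   [gam u 0 = 0] comes from [gam u 0 = - gam u 0]. *)
have [-> | v0] := eqVneq v 0.
  have K0 u : K u 0 = 0.
    have E : gam u 0 = 0.
      have := gamN u 0; rewrite oppr0 => /eqP; rewrite -addr_eq0 -mulr2n -scaler_nat.
      by rewrite scaler_eq0 pnatr_eq0 /= => /eqP.
    by rewrite /K !mul0mx E mul0mx addr0 subrr.
  by rewrite !K0 mul0mx subr0 !mul0mx mxE.
have [x [y ->]] := complex_line_sub jj rV Vj vV wV v0.
have [h1 h2] := K_orth (a *m j) v; have [h3 h4] := K_orth a v.
have h5 : ip (K a v *m j) (v *m j) = 0 by rewrite ipj.
have h6 : ip (K a v *m j) v = 0.
  by rewrite -ipj j1 ipNl h4 oppr0.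
by rewrite ipDl ipNl !ipDr !ipZr h1 h2 h5 h6 !mulr0; ring.
Qed.

End Superminimal.

(** * Naturality and superminimality on manifolds *)

Section Submersion.
Context {R : realType}.

Lemma differentiable_trmx (V : normedModType R) a b (F : V -> 'M[R]_(a, b)) p :
  differentiable F p -> differentiable (fun q => (F q)^T) p.
Proof.
move=> dF; apply: differentiable_mx => i k; under eq_fun do rewrite mxE.
exact: differentiable_entry.
Qed.

Lemma derive_trmx (V : normedModType R) a b (F : V -> 'M[R]_(a, b)) p v :
  differentiable F p -> 'D_v (fun q => (F q)^T) p = ('D_v F p)^T.
Proof.
move=> dF; apply/matrixP => i k.
apply: (etrans (esym (derive_entry v i k (differentiable_trmx dF)))).
apply: (etrans _ (esym (mxE _ _ _ _))); apply: (etrans _ (derive_entry v k i dF)).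
by congr (derive _ _ _); apply/funext => q; rewrite mxE.
Qed.

Lemma isometry_change_of_basis (K : comPzRingType) a (T T' A g : 'M[K]_a) :
  T' *m T = 1%:M -> A *m g *m A^T = g ->
  (T *m A *m T') *m (T *m g *m T^T) *m (T *m A *m T')^T = T *m g *m T^T.
Proof.
move=> TT Ag; rewrite mulmx_cancel // !trmx_mul.
have TT' : T^T *m T'^T = 1%:M by rewrite -trmx_mul TT trmx1.
rewrite -(mulmxA _ T^T) (mulmxA T^T T'^T) TT' mul1mx.
by rewrite mulmxA -(mulmxA T A) -(mulmxA T (A *m g)) Ag.
Qed.

Lemma intertwine_change_of_basis (K : pzSemiRingType) a b (T T' A : 'M[K]_a)
    (S S' B : 'M[K]_b) (D : 'M[K]_(a, b)) :
  T' *m T = 1%:M -> S *m S' = 1%:M -> A *m D = D *m B ->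
  (T *m A *m T') *m (T *m D *m S) = (T *m D *m S) *m (S' *m B *m S).
Proof. by move=> TT SS AD; rewrite !mulmx_cancel // -(mulmxA T A) AD mulmxA. Qed.

Lemma isometry_product_rule (K : comPzRingType) a
    (j dj g dg dg' : 'M[K]_a) (v w : 'rV[K]_a) :
  (dj *m g + j *m dg) *m j^T + j *m g *m dj^T = dg' ->
  (v *m j *m dg *m (w *m j)^T) 0 0 + (v *m dj *m g *m (w *m j)^T) 0 0
  + (v *m j *m g *m (w *m dj)^T) 0 0 = (v *m dg' *m w^T) 0 0.
Proof.
move=> <-; rewrite !(mulmxDr, mulmxDl) !trmx_mul !mulmxA.
rewrite [RHS]mxE [X in _ = X + _]mxE; congr (_ + _); exact: addrC.
Qed.

Section Metric.
Context {m : nat} {M : almostHermitian R m}.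
Implicit Types (x : M) (u v w : 'rV[R]_m).

Lemma dmetricNm x u v w : dmetric x u (- v) w = - dmetric x u v w.
Proof. by rewrite /dmetric !mulNmx mxE. Qed.

Lemma dmetricNl x u v w : dmetric x (- u) v w = - dmetric x u v w.
Proof.
rewrite dmetric_sum [in RHS]dmetric_sum -sumrN.
by apply: eq_bigr => l _; rewrite mxE mulNr.
Qed.

Lemma dmetricNr x u v w : dmetric x u v (- w) = - dmetric x u v w.
Proof. by rewrite dmetricC dmetricNm dmetricC. Qed.

Lemma christoffelN x u v : christoffel x u (- v) = - christoffel x u v.
Proof.
rewrite /christoffel -mulNmx; congr (_ *m _); apply/rowP => l.
rewrite !mxE dmetricNm dmetricNl dmetricNr.
move: (dmetric _ _ _ _) (dmetric _ _ _ _) (dmetric _ _ _ _) => a b c; ring.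
Qed.

Local Notation J x := (endo_in (chart_at x) (@acs R m M)).
Local Notation G x := (form_in (chart_at x) (@metric R m M)).

Lemma acs_chart_sqr x q : cimg (chart_at x) setT q -> J x q *m J x q = - 1%:M.
Proof.
move=> cq; apply: endo_in_sqr cq _; first exact: chart_atlas.
exact: acs_sqr.
Qed.

Lemma acs_chart_isometry x q : cimg (chart_at x) setT q ->
  J x q *m G x q *m (J x q)^T = G x q.
Proof.
move=> [y [_ cy] <-]; rewrite endo_inE // /form_in cmapK //.
apply: isometry_change_of_basis (acs_isometry y).
by apply: dtransK => //; [exact: chart_atlas|exact: chart_atlas|exact: chart_dom].
Qed.

Lemma acs_diff x : differentiable (J x) (pt x).
Proof. exact/endo_in_diff/acs_smooth. Qed.

Lemma chart_nbhs x : open (cimg (chart_at x) [set: M]) /\ cimg (chart_at x) setT (pt x).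
Proof.
split; first exact/cimg_open/openT.
by apply: cimg_map => //; exact: chart_dom.
Qed.

Lemma derive_acs_sqr x u :
  'D_u (J x) (pt x) *m J x (pt x) + J x (pt x) *m 'D_u (J x) (pt x) = 0.
Proof.
have dJ := acs_diff x; have [oc cp] := chart_nbhs x.
apply: (etrans (esym (derive_mulmx u dJ dJ))).
apply: (etrans (open_eq_derive u oc cp (@acs_chart_sqr x))).
exact: derive_cst.
Qed.

Lemma derive_acs_isometry x u v w (j := J x (pt x)) (dj := 'D_u (J x) (pt x)) :
  dmetric x u (v *m j) (w *m j) + ip x (v *m dj) (w *m j) + ip x (v *m j) (w *m dj)
  = dmetric x u v w.
Proof.
have dJ := acs_diff x; have dG := form_in_differentiable x.
have [oc cp] := chart_nbhs x.
have dJG := differentiable_mulmx dJ dG; have dJT := differentiable_trmx dJ.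
have gE : G x (pt x) = metric x.
  rewrite /form_in cmapK ?dtrans_id ?trmx1 ?mulmx1 ?mul1mx //; exact: chart_dom.
have := open_eq_derive u oc cp (@acs_chart_isometry x).
rewrite (derive_mulmx u dJG dJT) (derive_mulmx u dJ dG) (derive_trmx u dJ) gE.
exact: isometry_product_rule.
Qed.

End Metric.

Section Map.
Context {m n : nat} {M : almostHermitian R m} {N : almostHermitian R n}.
Context (phi : M -> N).
Implicit Types (x : M) (v w a : 'rV[R]_m).
Hypothesis phi_holomorphic : holomorphic_map phi.

Lemma vert_acs x : (vert phi x *m acs x <= vert phi x)%MS.
Proof.
have [_ H] := phi_holomorphic.
by apply/sub_kermxP; rewrite -mulmxA H mulmxA mulmx_ker mul0mx.
Qed.

Lemma nij_superminimal x a v w : superminimal_fibres phi ->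
  \rank (vert phi x) = 2%N ->
  (v <= vert phi x)%MS -> (w <= vert phi x)%MS -> ip x (nij x a v) w = 0.
Proof.
move=> SM rV vV wV.
have jE : endo_in (chart_at x) (@acs R m M) (pt x) = acs x by exact: endo_in_pt.
have h1 : endo_in (chart_at x) (@acs R m M) (pt x) *m
    endo_in (chart_at x) (@acs R m M) (pt x) = - 1%:M by rewrite jE acs_sqr.
have h2 : endo_in (chart_at x) (@acs R m M) (pt x) *m metric x *m
    (endo_in (chart_at x) (@acs R m M) (pt x))^T = metric x by rewrite jE acs_isometry.
rewrite /ip /nij /nijenhuis; apply: (torsion_superminimal
  (dj := fun u => 'D_u (endo_in (chart_at x) (@acs R m M)) (pt x)) (Defs.metric_sym x)
  h1 h2 (christoffelC x) (christoffelN x)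
  (christoffel_metric x) (derive_acs_isometry x) (derive_acs_sqr x) a rV _ _ vV wV).
  by rewrite jE; exact: vert_acs.
move=> u b uV; rewrite jE.
(* For a field with constant components [b], ordinary derivatives of the field vanish, so
   superminimality reduces to the pointwise relation between ['D_u] of J and the Christoffel
   form. *)
pose X : M -> 'rV[R]_m := chart_field (chart_at x) (fun=> b).
have od := cdom_open (chart_at x).
have := SM (phi x) _ X x u od (constant_field_smooth x b) (chart_dom x) erefl uV.
have Xx : X x = b by rewrite /X chart_field_at.
have [oc cp] := chart_nbhs x.
have E1 : 'D_u (field_in (chart_at x) X) (pt x) = 0.
  apply: (etrans (open_eq_derive u oc cp (g := fun=> b) _)); last exact: derive_cst.
  by move=> q cq; apply: field_in_chart_field => //; exact: chart_atlas.
have E2 : 'D_u (field_in (chart_at x) (fun y => X y *m acs y)) (pt x)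
   = b *m 'D_u (endo_in (chart_at x) (@acs R m M)) (pt x).
  apply: (etrans (open_eq_derive u oc cp
    (g := fun q => b *m endo_in (chart_at x) (@acs R m M) q) _)).
    move=> q cq; apply: (etrans (field_in_mul _ _ (chart_atlas x) cq)).
    by congr (_ *m _); apply: field_in_chart_field => //; exact: chart_atlas.
  have db : differentiable (fun _ : 'rV[R]_m => b) (pt x) by exact: differentiable_cst.
  apply: (etrans (derive_mulmx u db (acs_diff x))).
  by rewrite derive_cst mul0mx add0r.
by rewrite /nabla E1 E2 Xx add0r.
Qed.

Lemma local_rep_differentiable x c c' : atlas c -> atlas c' ->
  cdom c x -> cdom c' (phi x) ->
  differentiable (cmap c' \o phi \o cinv c) (cmap c x).
Proof.
have [[cphi sphi] _] := phi_holomorphic.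
move=> Ac Ac' cx cx'; apply: smooth_diff (sphi _ _ Ac Ac') _.
exact: cimg_map.
Qed.

Lemma jacobian_local_rep x c c' : atlas c -> atlas c' -> cdom c x -> cdom c' (phi x) ->
  jacobian (cmap c' \o phi \o cinv c) (cmap c x) =
  dtrans c (chart_at x) x *m mdiff phi x *m dtrans (chart_at (phi x)) c' (phi x).
Proof.
move=> Ac Ac' cx cx'.
have [[cphi _] _] := phi_holomorphic.
have A1 := chart_atlas x; have d1 := chart_dom x.
have A2 := chart_atlas (phi x); have d2 := chart_dom (phi x).
rewrite /dtrans /mdiff.
set f1 := cmap (chart_at x) \o cinv c.
set f2 := cmap (chart_at (phi x)) \o phi \o cinv (chart_at x).
set f3 := cmap c' \o cinv (chart_at (phi x)).
have E1 : f1 (cmap c x) = pt x by rewrite /f1 /= cmapK.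
have E2 : f2 (pt x) = pt (phi x) by rewrite /f2 /pt /= cmapK.
have D1 : differentiable f1 (cmap c x) by exact: trans_differentiable.
have D2 : differentiable f2 (pt x) by exact: local_rep_differentiable.
have D3 : differentiable f3 (pt (phi x)) by exact: trans_differentiable.
rewrite -E1 in D2; have D21 := differentiable_comp D1 D2.
have E21 : (f2 \o f1) (cmap c x) = pt (phi x) by rewrite /= E1 E2.
rewrite -E21 in D3.
have := jacobian_comp D21 D3; rewrite (jacobian_comp D1 D2) E1 E21 => <-.
(* The factorisation through the preferred charts at [x] and [phi x] holds only where these charts
   are defined; that set is open and contains [x], which is enough for Jacobians. *)
apply: (open_eq_jacobian (U := cimg c (cdom (chart_at x) `&`
  phi @^-1` (cdom (chart_at (phi x)) `&` cdom c')))).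
- apply: cimg_open; apply: openI; first exact: cdom_open.
  by apply: open_comp; [move=> y _; exact: cphi|apply: openI; exact: cdom_open].
- by apply: cimg_map => //; split.
- move=> _ [y [[y1 [y2 y3]] cy] <-].
  by rewrite /f1 /f2 /f3 /= (cmapK cy) (cmapK y1) (cmapK y2).
- exact: local_rep_differentiable.
Qed.

Lemma nij_natural x a c :
  nij x a c *m mdiff phi x = nij (phi x) (a *m mdiff phi x) (c *m mdiff phi x).
Proof.
have [[cphi sphi] hphi] := phi_holomorphic.
have A1 := chart_atlas x; have d1 := chart_dom x.
have A2 := chart_atlas (phi x); have d2 := chart_dom (phi x).
pose f := cmap (chart_at (phi x)) \o phi \o cinv (chart_at x).
have fp : f (pt x) = pt (phi x) by rewrite /f /pt /= cmapK.
rewrite /nij -fp; apply: (nijenhuis_natural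
  (U := cimg (chart_at x) (phi @^-1` cdom (chart_at (phi x)))) (f := f)).
- apply: cimg_open; apply: open_comp; last exact: cdom_open.
  by move=> y _; exact: cphi.
- exact: cimg_map.
- exact: sphi.
- move=> _ [y [y2 y1] <-].
  have E : f (cmap (chart_at x) y) = cmap (chart_at (phi x)) (phi y) by rewrite /f /= cmapK.
  (* Holomorphy at [y] is stated in the preferred charts of [y] and [phi y]; to be differentiated at
     [x] it must be read in one fixed pair of charts for all nearby [y]. *)
  rewrite -/f E (jacobian_local_rep A1 A2 y1 y2) (endo_inE _ y1) (endo_inE _ y2).
  have B1 := chart_atlas y; have e1 := chart_dom y.
  have B2 := chart_atlas (phi y); have e2 := chart_dom (phi y).
  have K1 := dtransK B1 A1 e1 y1; have K2 := dtransK B2 A2 e2 y2.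
  exact: intertwine_change_of_basis K1 K2 (hphi y).
- exact: acs_diff.
- by rewrite fp; exact: acs_diff.
- by rewrite fp endo_in_pt acs_sqr.
Qed.

End Map.
End Submersion.

(** * Horizontal sections and the conclusion *)

Section Final.
Context {R : realType}.

(** Since [\adj G *m G] is the scalar [\det G], pairing the vector with [V] under the metric gives
    [\det G] times the value on [V] of a covector pulled back by [D], which kills the kernel of
    [D]. *)
Lemma adjugate_orthogonal (K : comPzRingType) m n (T T' g G : 'M[K]_m)
    (D D' : 'M[K]_(m, n)) (S : 'M[K]_n) (V : 'M[K]_m) (y : 'rV[K]_n) :
  T *m T' = 1%:M -> V *m D = 0 -> G = T' *m g *m T'^T -> D' = T' *m D *m S ->
  y *m D'^T *m \adj G *m T' *m (g *m V^T) = 0.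
Proof.
move=> TT VD GE DE.
have E : T' *m (g *m V^T) = G *m (V *m T)^T.
  rewrite GE trmx_mul !mulmxA -(mulmxA _ T'^T) -trmx_mul TT trmx1 mulmx1 //.
rewrite -mulmxA E mulmxA -(mulmxA _ (\adj G)) mul_adj_mx.
rewrite mul_mx_scalar -scalemxAl -mulmxA -trmx_mul DE.
rewrite !mulmxA -(mulmxA V T) TT mulmx1 VD mul0mx trmx0 mulmx0 scaler0 //.
Qed.

Context {m n : nat} {M : almostHermitian R m} {N : almostHermitian R n}.
Context (phi : M -> N).
Implicit Types (x : M) (a c h u v w : 'rV[R]_m).

Lemma ip_gt0 x u : u != 0 -> 0 < ip x u u.
Proof. exact: metric_gt0. Qed.

Lemma ip_acs x u v : ip x (u *m acs x) (v *m acs x) = ip x u v.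
Proof.
rewrite /ip trmx_mul !mulmxA -(mulmxA _ (acs x) (metric x)).
by rewrite -(mulmxA u (acs x *m metric x)) acs_isometry.
Qed.

Lemma horP x u :
  reflect (forall v, (v <= vert phi x)%MS -> ip x u v = 0) (u <= hor phi x)%MS.
Proof.
apply: (iffP sub_kermxP) => [H v /submxP[k ->]|H].
  by rewrite /ip trmx_mul mulmxA -(mulmxA u) H mul0mx mxE.
apply/rowP => i; rewrite mulmxA [RHS]mxE -(H (row i (vert phi x))) ?row_sub //.
rewrite /ip; move: (u *m _) (vert phi x) => b V.
by rewrite !mxE; apply: eq_bigr => k _; rewrite !mxE.
Qed.

Lemma vert_cap_hor x : (vert phi x :&: hor phi x)%MS = 0.
Proof.
apply/eqP/rowV0P => v; rewrite sub_capmx => /andP[vV /horP/(_ v vV) v0].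
by apply/eqP; apply: contraT => /(ip_gt0 x); rewrite v0 ltxx.
Qed.

Lemma rank_hor x : \rank (hor phi x) = (m - \rank (vert phi x))%N.
Proof.
by rewrite mxrank_ker eqmxMfull ?mxrank_tr // row_full_unit; exact: metric_unit.
Qed.

Lemma vert_hor_decomposition x u :
  exists v h, [/\ u = v + h, (v <= vert phi x)%MS & (h <= hor phi x)%MS].
Proof.
have : (u <= vert phi x + hor phi x)%MS.
  apply: submx_full; rewrite /row_full mxrank_disjoint_sum ?vert_cap_hor //.
  by rewrite rank_hor subnKC ?rank_leq_row.
by case/sub_addsmxP => k ->; exists (k.1 *m vert phi x), (k.2 *m hor phi x); split;
  rewrite ?submxMl.
Qed.

Lemma vproj_vert x v : (v <= vert phi x)%MS -> v *m vproj phi x = v.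
Proof. by move=> vV; apply: proj_mx_id => //; exact: vert_cap_hor. Qed.

Lemma vproj_hor x h : (h <= hor phi x)%MS -> h *m vproj phi x = 0.
Proof. by move=> hH; apply: proj_mx_0 => //; exact: vert_cap_hor. Qed.

(** Lowering the index of a horizontal vector gives a covector vanishing on the kernel of the
    differential; by a rank count such covectors are exactly those pulled back from the target. *)
Lemma hor_metric x h : (h <= hor phi x)%MS ->
  exists y : 'rV[R]_n, h *m metric x = y *m (mdiff phi x)^T.
Proof.
move=> /sub_kermxP; rewrite mulmxA => /sub_kermxP hV.
have DV : ((mdiff phi x)^T <= kermx (vert phi x)^T)%MS.
  by apply/sub_kermxP; rewrite -trmx_mul mulmx_ker trmx0.
suff /(submx_trans hV)/submxP[y E] : (kermx (vert phi x)^T <= (mdiff phi x)^T)%MS.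
  by exists y.
rewrite -(geq_leqif (mxrank_leqif_sup DV)) mxrank_ker !mxrank_tr mxrank_ker.
by rewrite subKn // rank_leq_row.
Qed.

Hypothesis phi_holomorphic : holomorphic_map phi.

Lemma hor_acs x h : (h <= hor phi x)%MS -> (h *m acs x <= hor phi x)%MS.
Proof.
move=> /horP hH; apply/horP => v vV.
have vJ : (v *m acs x <= vert phi x)%MS.
  by apply: submx_trans (vert_acs phi_holomorphic x); exact: submxMr.
have : ip x h (v *m acs x) = 0 by exact: hH.
by rewrite -ip_acs acsK /ip linearN /= mulmxN mxE => /eqP; rewrite oppr_eq0 => /eqP.
Qed.

Lemma vproj_acs x u : u *m acs x *m vproj phi x = u *m vproj phi x *m acs x.
Proof.
have [v [h [-> vV hH]]] := vert_hor_decomposition x u.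
have vJ : (v *m acs x <= vert phi x)%MS.
  by apply: submx_trans (vert_acs phi_holomorphic x); exact: submxMr.
rewrite !mulmxDl (vproj_vert vV) (vproj_vert vJ) (vproj_hor hH) (vproj_hor (hor_acs hH)).
by rewrite mul0mx.
Qed.

(* Metric duals of covectors pulled back from N are horizontal; using the
   adjugate of g instead of its inverse only rescales them, and keeps them
   polynomial in smooth data. *)
Lemma horizontal_section x h : (h <= hor phi x)%MS ->
  exists (U : set M) (X : M -> 'rV[R]_m), [/\ open U, U x, smooth_field U X,
    X x = h & forall y, U y -> (X y <= hor phi y)%MS].
Proof.
move=> hH; have [y0 hy] := hor_metric hH.
have [[cphi sphi] hphi] := phi_holomorphic.
have A1 := chart_atlas x; have d1 := chart_dom x.
have A2 := chart_atlas (phi x); have d2 := chart_dom (phi x).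
pose f := cmap (chart_at (phi x)) \o phi \o cinv (chart_at x).
pose G := form_in (chart_at x) (@metric R m M).
(* At [x] the adjugate is [\det (metric x)] times the inverse metric; this normalisation makes the
   section pass exactly through [h]. *)
pose y1 := (\det (metric x))^-1 *: y0.
pose F q := y1 *m (jacobian f q)^T *m \adj (G q).
pose U := cdom (chart_at x) `&` phi @^-1` cdom (chart_at (phi x)).
have oU : open U.
  apply: openI; first exact: cdom_open.
  by apply: open_comp; [move=> y _; exact: cphi|exact: cdom_open].
have oc : open (cimg (chart_at x) U) by exact: cimg_open.
exists U, (chart_field (chart_at x) F); split.
- exact: oU.
- by split.
- apply: (smooth_chart_field oU _ A1); first by move=> y [].
  apply: (smooth_on_mulmx oc).
    apply: (smooth_on_mulmx oc); first exact: smooth_on_cst.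
    apply: (smooth_on_trmx oc); apply: (smooth_on_jacobian oc).
    apply: smooth_on_subset (sphi _ _ A1 A2); apply: cimg_subset.
    by move=> y [].
  apply: (smooth_on_adjugate oc).
  by apply: smooth_on_subset (metric_smooth A1); exact: cimg_subset.
- have gE : G (pt x) = metric x.
    by rewrite /G /form_in cmapK // dtrans_id // trmx1 mulmx1 mul1mx.
  rewrite chart_field_at /F gE /y1 -!scalemxAl.
  rewrite -[jacobian f (pt x)]/(mdiff phi x) -hy -mulmxA mul_mx_adj mul_mx_scalar.
  by rewrite scalerA mulVf ?scale1r // -unitfE -unitmxE metric_unit.
- move=> y [cy cy']; apply/sub_kermxP; rewrite /chart_field.
  have B1 := chart_atlas y; have e1 := chart_dom y.
  have VD : vert phi y *m mdiff phi y = 0 by exact: mulmx_ker.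
  have GE : G (cmap (chart_at x) y) = dtrans (chart_at x) (chart_at y) y *m metric y
      *m (dtrans (chart_at x) (chart_at y) y)^T by rewrite /G /form_in cmapK.
  have JE := jacobian_local_rep phi_holomorphic A1 A2 cy cy'.
  exact: (adjugate_orthogonal y1 (dtransK B1 A1 e1 cy) VD GE JE).
Qed.

Hypothesis fibre_dim : forall x : M, \rank (vert phi x) = 2%N.
Hypothesis fibres_superminimal : superminimal_fibres phi.
Hypothesis horizontal_bracket : H10_bracket_in_V10 phi.
Hypothesis N_hermitian : integrable_acs N.

Lemma nij_vert x a c : (nij x a c <= vert phi x)%MS.
Proof.
by apply/sub_kermxP; rewrite nij_natural //; exact: integrable_nij0.
Qed.

Lemma nij_vertical_r x a v : (v <= vert phi x)%MS -> nij x a v = 0.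
Proof.
move=> vV; apply/eqP; apply: contraT => /(ip_gt0 x).
have -> : ip x (nij x a v) (nij x a v) = 0; last by rewrite ltxx.
by apply: (nij_superminimal phi_holomorphic _ fibres_superminimal
  (fibre_dim x) vV); exact: nij_vert.
Qed.

Lemma nij_horizontal x h h' : (h <= hor phi x)%MS -> (h' <= hor phi x)%MS ->
  nij x h h' = 0.
Proof.
move=> hH hH'.
have [U1 [X [oU1 Ux1 CX Xx XH]]] := horizontal_section hH.
have [U2 [Y [oU2 Ux2 CY Yx YH]]] := horizontal_section hH'.
pose U := U1 `&` U2; have oU : open U by exact: openI.
have Ux : U x by split.
have restrict (U' : set M) (X' : M -> 'rV[R]_m) :
    U `<=` U' -> smooth_field U' X' -> smooth_field U X'.
  by move=> s CX' k Ak; apply: smooth_on_subset (CX' k Ak); exact: cimg_subset.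
have CZ : smooth_cfield U (field10 X).
  by apply: smooth_field10 => //; apply: restrict CX => y [].
have CW : smooth_cfield U (field10 Y).
  by apply: smooth_field10 => //; apply: restrict CY => y [].
have H10f (X' : M -> 'rV[R]_m) y : (X' y <= hor phi y)%MS -> H10 phi y (field10 X' y).
  move=> XH'; split; first exact: T10_field10.
  by apply: (cplx_submx XH'); rewrite eqmx_opp; exact: hor_acs.
have HZ y : U y -> H10 phi y (field10 X y) by case=> /XH ? _; exact: H10f.
have HW y : U y -> H10 phi y (field10 Y y) by case=> _ /YH ?; exact: H10f.
have [P [Q [PQ E]]] := cbracket_T10_sections oU CZ CW
  (fun y Uy => (HZ y Uy).1) (fun y Uy => (HW y Uy).1) Ux.
have [+ _] := horizontal_bracket oU CZ CW HZ HW Ux.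
rewrite PQ cplx_mulr => /T10P QP; rewrite !re_field10 Xx Yx in E.
(* Projection commutes with J, so (ii) kills the projected left-hand side. On the right, [nij] and
   its image under J are vertical and hence fixed by the projection. *)
have /(congr1 (fun z => z *m vproj phi x)) := E.
rewrite mulmxDl vproj_acs QP subrr mulNmx mulNmx vproj_vert; last first.
  apply: submx_trans (vert_acs phi_holomorphic x); exact: submxMr (nij_vert _ _ _).
by move=> /esym/eqP; rewrite oppr_eq0 => /eqP; exact: acs_inj.
Qed.

Lemma nij_eq0 x a c : nij x a c = 0.
Proof.
have nijDl b b' d : nij x (b + b') d = nij x b d + nij x b' d.
  by apply: nijenhuisDl; exact: acs_diff.
have nijC b d : nij x b d = - nij x d b by exact: nijenhuisC.
have [v [h [-> vV hH]]] := vert_hor_decomposition x a.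
have [v' [h' [-> vV' hH']]] := vert_hor_decomposition x c.
rewrite nijDl nijC (nij_vertical_r _ vV) oppr0 add0r nijC nijDl.
by rewrite nijC (nij_vertical_r _ vV') oppr0 add0r nij_horizontal // oppr0.
Qed.

End Final.

End SubmersionsWithSuperminimalFibres.

Theorem theorem5p1 (R : realType) (m n : nat)
    (M : almostHermitian R m) (N : almostHermitian R n) (phi : M -> N)
    (N_hermitian : integrable_acs N)
    (phi_holomorphic : holomorphic_map phi)
    (phi_conformal : horizontally_conformal phi)
    (fibre_dim : forall x : M, \rank (vert phi x) = 2)
    (fibres_superminimal : superminimal_fibres phi)
    (horizontal_bracket : H10_bracket_in_V10 phi) :
  integrable_acs M.
Proof.
apply: nij0_integrable => x a c.
exact: (nij_eq0 phi_holomorphic fibre_dim fibres_superminimal horizontal_bracket N_hermitian).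
Qed.
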